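(* Let $U$ be a bounded entropy solution of the system $$\partial_t(a\rho)+\partial_x(a\rho u)=0,\quad \partial_t(a\rho u)+\partial_x(a\rho u^2)+a\,\partial_x p=0,\quad \partial_t(a\rho e)+\partial_x\big(au(\rho e+p)\big)=0,\quad \partial_ta=0,\qquad x\in\mathbb R,\ t>0 .$$ Then its specific entropy $S$ satisfies the minimum entropy principle: for all $R>0$ and $t>0$, $$\inf_{|x|\le R}S(x,t)\ \ge\ \inf_{|x|\le R+t\|u\|_{L^\infty}}S(x,0).$$
   Context: Unknowns: $\rho>0$ is the density, $u$ the velocity, $\varepsilon$ the specific internal energy, $e=\varepsilon+u^2/2$ the total energy, $v=1/\rho$ the specific volume, $p$ the pressure, $T>0$ the temperature, $S$ the specific entropy, $a=a(x)>0$ the (possibly discontinuous) cross-section. The thermodynamic variables are related by smooth equations of state $p=p(\rho,\varepsilon)$, $S=S(\rho,\varepsilon)$ with $d\varepsilon=T\,dS-p\,dv$. Standing assumption (local thermodynamic equilibrium): the map $(v,\varepsilon)\mapsto S(v,\varepsilon)$ is strictly concave. The system is written as $\partial_tU+A(U)\partial_xU=0$ with $U=(a\rho,a\rho u,a\rho e,a)$, and weak solutions are understood in the sense of Dal Maso, LeFloch and Murat: the equation holds as an equality of measures with $A(U)\partial_xU$ replaced by $[A(U)\partial_xU]_\phi$, where, for a fixed Lipschitz family of paths $\phi(s;U_0,U_1)$ ($s\in[0,1]$, $\phi(0;U_0,U_1)=U_0$, $\phi(1;U_0,U_1)=U_1$) and $U$ of bounded variation in $x$ locally, $[A(U)\partial_xU]_\phi$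 equals $A(U)\partial_xU$ on Borel subsets of the set of continuity points of $U$ and has mass $\int_0^1A(\phi(s;U_-,U_+))\partial_s\phi(s;U_-,U_+)\,ds$ at a jump point with one-sided limits $U_\pm$. An entropy solution is a weak solution satisfying, in the sense of distributions, $$\partial_t(a\rho\,g(S))+\partial_x(a\rho u\,g(S))\le0$$ for every twice differentiable function $g$ such that (i) $g(S)$ is strictly decreasing as a function of $S$ and (ii) $g(S)$ is strictly convex as a function of $(1/\rho,\varepsilon)$, on the domain of states under consideration. This domain is convex in $(v,\varepsilon)$, contains the values of the solution, and $S$ is bounded on it. ''Bounded'' means that $\rho,u,\varepsilon,S,a$ are in $L^\infty$; $\|u\|_{L^\infty}$ is the supremum norm over all $(x,t)$. The solution is continuous in time with values in $L^1_{\mathrm{loc}}(\mathbb R)$, including $t=0$, so $U(\cdot,t)$ and $U(\cdot,0)$ make sense; infima are essential infima in $x$. *)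

(* Defs.v *)
From HB Require Import structures.
From mathcomp Require Import all_boot all_order all_algebra.
From mathcomp Require Import all_classical all_reals all_analysis.
From mathcomp Require Import measurable_realfun ess_sup_inf.

Set Implicit Arguments.
Unset Strict Implicit.
Unset Printing Implicit Defensive.

Import Order.TTheory GRing.Theory Num.Theory.
Import numFieldNormedType.Exports.

Local Open Scope classical_set_scope.
Local Open Scope ring_scope.

(* [f] is C^oo on the open set [A]: all iterated directional derivatives exist
   and are continuous on [A]. *)
Definition smooth_on (R : realType) (V : normedModType R) (A : set V)
    (f : V -> R) : Prop :=
  forall (vs : seq V) (z : V), A z ->
    let g := foldr (fun v h => 'D_v h) f vs in
    {for z, continuous g} /\ forall v, derivable g z v.

Definition strictly_convex_on (R : realType) (A : set (R * R))
    (f : R * R -> R) : Prop :=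
  forall (z w : R * R) (l : R), A z -> A w -> z != w -> 0 < l < 1 ->
    f (l *: z + (1 - l) *: w) < l * f z + (1 - l) * f w.

Definition strictly_concave_on (R : realType) (A : set (R * R))
    (f : R * R -> R) : Prop :=
  strictly_convex_on A (fun z => - f z).

(* Exchanges (rho, eps) and (v, eps), where v = 1 / rho. *)
Definition inv_fst (R : realType) (z : R * R) : R * R := (z.1^-1, z.2).

(* [pressure], [temperature] and [entropy] are functions of (rho, eps), while
   [eos_dom] is a set of pairs (v, eps).  In [gibbs], [h] = (dv, deps). *)
Record eos (R : realType) := Eos {
  eos_dom : set (R * R) ;
  pressure : R * R -> R ;
  temperature : R * R -> R ;
  entropy : R * R -> R ;
  eos_dom_open : open eos_dom ;
  eos_dom_convex : convex_set eos_dom ;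
  eos_dom_gt0 : forall z, eos_dom z -> 0 < z.1 ;
  pressure_smooth : smooth_on (@inv_fst R @^-1` eos_dom) pressure ;
  entropy_smooth : smooth_on (@inv_fst R @^-1` eos_dom) entropy ;
  temperature_gt0 : forall z, eos_dom z -> 0 < temperature (inv_fst z) ;
  gibbs : forall z h : R * R, eos_dom z ->
    h.2 = temperature (inv_fst z) * 'D_h (entropy \o @inv_fst R) z
          - pressure (inv_fst z) * h.1 ;
  entropy_concave : strictly_concave_on eos_dom (entropy \o @inv_fst R)
}.

(* Components 0, 1, 2, 3 are a rho, a rho u, a rho e and a. *)
Definition conserved (R : realType) (a rho u eps : R) : 'rV[R]_4 :=
  \row_(i < 4) [:: a * rho; a * rho * u; a * rho * (eps + u ^+ 2 / 2); a]`_i.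

Definition phase_space (R : realType) (E : eos R) : set 'rV[R]_4 :=
  [set U | exists a rho u eps : R,
    [/\ U = conserved a rho u eps, 0 < a, 0 < rho &
        eos_dom E (rho^-1, eps)]].

Definition pressure_of (R : realType) (E : eos R) (U : 'rV[R]_4) : R :=
  pressure E (U 0 0 / U 0 3, U 0 2 / U 0 0 - (U 0 1 / U 0 0) ^+ 2 / 2).

(* Row i holds the coefficients of d_x U_0, ..., d_x U_3 in the chain-rule
   expansion of the x-terms of equation i:
   d_x (a rho u), d_x (a rho u^2) + a d_x p, d_x (u (a rho e + a p)) and 0. *)
Definition system_matrix (R : realType) (E : eos R) (U : 'rV[R]_4) : 'M[R]_4 :=
  \matrix_(i, j)
    let e : 'rV[R]_4 := delta_mx 0 j in
    [:: 'D_e (fun V : 'rV[R]_4 => V 0 1) U ;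
        'D_e (fun V : 'rV[R]_4 => V 0 1 ^+ 2 / V 0 0) U
          + U 0 3 * 'D_e (pressure_of E) U ;
        'D_e (fun V : 'rV[R]_4 =>
                V 0 1 / V 0 0 * (V 0 2 + V 0 3 * pressure_of E V)) U ;
        0]`_i.

(* The Lipschitz bound is only asked for on compact sets of states, which covers
   both global Lipschitz continuity and the conditions of Dal Maso, LeFloch and
   Murat. *)
Definition lipschitz_paths (R : realType) (O : set 'rV[R]_4)
    (phi : R -> 'rV[R]_4 -> 'rV[R]_4 -> 'rV[R]_4) : Prop :=
  [/\ forall U0 U1, O U0 -> O U1 -> phi 0 U0 U1 = U0 /\ phi 1 U0 U1 = U1,
      forall s U0 U1, 0 <= s <= 1 -> O U0 -> O U1 -> O (phi s U0 U1) &
      forall K : set 'rV[R]_4, compact K -> K `<=` O ->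
        exists k : R, forall s s' U0 U0' U1 U1',
          0 <= s <= 1 -> 0 <= s' <= 1 -> K U0 -> K U0' -> K U1 -> K U1' ->
          `|phi s U0 U1 - phi s' U0' U1'| <=
            k * (`|s - s'| + `|U0 - U0'| + `|U1 - U1'|)].

(* A signed measure on the line, finite on bounded sets, is represented by a
   pair (mp, mn) of locally finite positive measures, standing for mp - mn; the
   two need not be mutually singular. *)
Definition locally_finite (R : realType)
    (m : {measure set (measurableTypeR R) -> \bar R}) : Prop :=
  forall K : set R, compact K -> (m K < +oo)%E.

Definition derivative_measure (R : realType)
    (mp mn : {measure set (measurableTypeR R) -> \bar R}) (f : R -> R) : Prop :=
  [/\ locally_finite mp, locally_finite mn &
      forall c d : R, c < d ->
        fine (mp `]c, d]%classic) - fine (mn `]c, d]%classic) =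
        lim (f y @[y --> d^'+]) - lim (f y @[y --> c^'+])].

Definition left_limit (R : realType) (W : R -> 'rV[R]_4) (x : R) : 'rV[R]_4 :=
  \row_i lim (W y 0 i @[y --> x^'-]).

Definition right_limit (R : realType) (W : R -> 'rV[R]_4) (x : R) : 'rV[R]_4 :=
  \row_i lim (W y 0 i @[y --> x^'+]).

(* The set where both one-sided limits of [W] agree.  The pointwise value of [W]
   may still differ there, but only on a countable set, which the derivative of
   [W] does not charge. *)
Definition continuity_set (R : realType) (W : R -> 'rV[R]_4) : set R :=
  [set x | left_limit W x = right_limit W x].

Definition bv_loc (R : realType) (W : R -> 'rV[R]_4) : Prop :=
  forall (i : 'I_4) (c d : R), c < d ->
    bounded_variation c d (fun x => W x 0 i).

(* The vector-valued measure np - nn is the product [A(W) d_x W]_phi, for [W]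
   with values in the set [O] of states on which [A] and [phi] are meaningful. *)
Definition dlm_product (R : realType) (O : set 'rV[R]_4)
    (A : 'rV[R]_4 -> 'M[R]_4) (phi : R -> 'rV[R]_4 -> 'rV[R]_4 -> 'rV[R]_4)
    (W : R -> 'rV[R]_4)
    (np nn : 'I_4 -> {measure set (measurableTypeR R) -> \bar R}) : Prop :=
  exists dp dn : 'I_4 -> {measure set (measurableTypeR R) -> \bar R},
  [/\ forall i, locally_finite (np i) /\ locally_finite (nn i),
      forall j, derivative_measure (dp j) (dn j) (fun x => W x 0 j),
      forall (i : 'I_4) (B : set (measurableTypeR R)), measurable B ->
        B `<=` continuity_set W -> (exists c : R, B `<=` `[- c, c]) ->
        (forall j, (dp j).-integrable B (EFin \o (fun x => A (W x) i j)) /\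
                   (dn j).-integrable B (EFin \o (fun x => A (W x) i j))) /\
        fine (np i B) - fine (nn i B) =
        \sum_j (\int[dp j]_(x in B) A (W x) i j
                - \int[dn j]_(x in B) A (W x) i j) &
      forall (i : 'I_4) (x : R), ~ continuity_set W x ->
        let Um := left_limit W x in
        let Up := right_limit W x in
        [/\ O Um, O Up &
        fine (np i [set x]) - fine (nn i [set x]) =
        \int[lebesgue_measure]_(s in `[0, 1])
          \sum_j A (phi s Um Up) i j * derive1 (fun s' => phi s' Um Up 0 j) s]].

(* Functions of (x, t); only the values for t >= 0 matter. *)
Record flow (R : realType) := Flow {
  density : R * R -> R ;
  velocity : R * R -> R ;
  energy : R * R -> R ;
  cross_section : R -> R
}.

Definition flow_state (R : realType) (F : flow R) (z : R * R) : 'rV[R]_4 :=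
  conserved (cross_section F z.1) (density F z) (velocity F z) (energy F z).

Definition flow_entropy (R : realType) (E : eos R) (F : flow R) (z : R * R) : R :=
  entropy E (density F z, energy F z).

Definition half_plane (R : realType) : set (R * R) := [set z | 0 < z.2].

Definition lebesgue2 (R : realType) :
    {measure set (measurableTypeR R * measurableTypeR R) -> \bar R} :=
  (@lebesgue_measure R \x @lebesgue_measure R)%E.

Definition Linfty_norm (R : realType) (f : R * R -> R) : \bar R :=
  ('N[@lebesgue2 R]_+oo[EFin \o (f \_ (@half_plane R))])%E.

Definition test_function (R : realType) (th : R * R -> R) : Prop :=
  smooth_on setT th /\
  exists K : set (R * R),
    [/\ compact K, K `<=` @half_plane R & forall z, ~ K z -> th z = 0].

(* [A(U) d_x U]_phi is a family of measures in x indexed by t, given by the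
   kernels np i - nn i and locally finite in (x, t); the last clause is
   d_t U + [A(U) d_x U]_phi = 0 as measures on R x ]0, +oo[. *)
Definition weak_solution (R : realType) (E : eos R)
    (phi : R -> 'rV[R]_4 -> 'rV[R]_4 -> 'rV[R]_4) (F : flow R) : Prop :=
  let U := flow_state F in
  exists np nn : 'I_4 -> R.-ker (measurableTypeR R) ~> (measurableTypeR R),
  [/\ {ae @lebesgue_measure R, forall t, 0 < t -> bv_loc (fun x => U (x, t))},
      {ae @lebesgue_measure R, forall t, 0 < t ->
        dlm_product (phase_space E) (system_matrix E) phi (fun x => U (x, t))
          (fun i => np i t) (fun i => nn i t)},
      forall (i : 'I_4) (K : set R) (c d : R), compact K -> 0 < c -> c < d ->
        (\int[lebesgue_measure]_(t in `[c, d]) (np i t K + nn i t K) < +oo)%E &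
      forall (i : 'I_4) (th : R * R -> R), test_function th ->
        \int[@lebesgue2 R]_(z in @half_plane R) (U z 0 i * 'D_(0, 1) th z) =
        \int[lebesgue_measure]_(t in `]0, +oo[)
          (\int[np i t]_x th (x, t) - \int[nn i t]_x th (x, t))].

Definition time_continuous (R : realType) (F : flow R) : Prop :=
  let U := flow_state F in
  (forall (i : 'I_4) (t : R), 0 <= t ->
     locally_integrable setT (fun x => U (x, t) 0 i)) /\
  (forall (i : 'I_4) (t0 c : R), 0 <= t0 ->
    (\int[lebesgue_measure]_(x in `[(- c)%R, c])
       (`|U (x, t) 0 i - U (x, t0) 0 i|%R)%:E)%E
      @[t --> within `[0, +oo[ (nbhs t0)] --> 0%E).

(* Set D of pairs (v, eps): the domain of states under consideration. *)
Definition state_domain (R : realType) (E : eos R) (D : set (R * R)) : Prop :=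
  [/\ D `<=` eos_dom E, convex_set D &
      exists M : R, forall z, D z -> `|entropy E (inv_fst z)| <= M].

Definition entropy_function (R : realType) (E : eos R) (D : set (R * R))
    (g : R -> R) : Prop :=
  [/\ forall s, derivable g s 1 /\ derivable (derive1 g) s 1,
      forall z w, D z -> D w ->
        entropy E (inv_fst z) < entropy E (inv_fst w) ->
        g (entropy E (inv_fst w)) < g (entropy E (inv_fst z)) &
      strictly_convex_on D (fun z => g (entropy E (inv_fst z)))].

Definition entropy_inequality (R : realType) (E : eos R) (F : flow R)
    (g : R -> R) : Prop :=
  forall th : R * R -> R, test_function th -> (forall z, 0 <= th z) ->
    0 <= \int[@lebesgue2 R]_(z in @half_plane R)
      (cross_section F z.1 * density F z * g (flow_entropy E F z)
         * 'D_(0, 1) th z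
       + cross_section F z.1 * density F z * velocity F z
         * g (flow_entropy E F z) * 'D_(1, 0) th z).

Definition physical (R : realType) (D : set (R * R)) (F : flow R) : Prop :=
  [/\ forall x, 0 < cross_section F x,
      forall x t, 0 <= t -> 0 < density F (x, t),
      forall x t, 0 <= t -> D ((density F (x, t))^-1, energy F (x, t)),
      measurable_fun [set: R] (cross_section F) &
      let closed_half_plane := [set z : R * R | 0 <= z.2] in
      [/\ measurable_fun closed_half_plane (density F),
          measurable_fun closed_half_plane (velocity F) &
          measurable_fun closed_half_plane (energy F)]].

Definition entropy_solution (R : realType) (E : eos R) (D : set (R * R))
    (phi : R -> 'rV[R]_4 -> 'rV[R]_4 -> 'rV[R]_4) (F : flow R) : Prop :=
  [/\ physical D F, time_continuous F, weak_solution E phi F &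
      forall g, entropy_function E D g -> entropy_inequality E F g].

Definition bounded_flow (R : realType) (E : eos R) (F : flow R) : Prop :=
  [/\ (Linfty_norm (density F) < +oo)%E,
      (Linfty_norm (velocity F) < +oo)%E,
      (Linfty_norm (energy F) < +oo)%E,
      (Linfty_norm (flow_entropy E F) < +oo)%E &
      ('N[@lebesgue_measure R]_+oo[EFin \o cross_section F] < +oo)%E].

Definition essinf_centered (R : realType) (r : R) (f : R -> R) : \bar R :=
  ess_inf (mrestr (@lebesgue_measure R) (measurable_itv `[- r, r]))
    (EFin \o f).

(* Main.v *)
Require Import Defs.
From HB Require Import structures.
From mathcomp Require Import all_boot all_order all_algebra.
From mathcomp Require Import all_classical all_reals all_analysis.
From mathcomp Require Import measurable_realfun ess_sup_inf.
From mathcomp Require Import ring lra.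

Set Implicit Arguments.
Unset Strict Implicit.
Unset Printing Implicit Defensive.

Import Order.TTheory GRing.Theory Num.Theory.
Import numFieldNormedType.Exports.

Local Open Scope classical_set_scope.
Local Open Scope ring_scope.

(** For k > 0 the function g_k(S) = exp (k (s - S)) is decreasing, and convex in
    (v, eps) because S is concave.  Test the entropy inequality of g_k with
    chi(t) phi(x, t), where phi(x, t) = f(r' - L t - x) f(r' - L t + x),
    f(y) = exp (- 1 / y) for y > 0 and f = 0 elsewhere, L = ||u||_oo and
    r' = r + t L: the support of phi shrinks at speed L, so that
    phi_t + u phi_x <= 0, and m_k(t) = int a rho g_k(S) phi dx is nonincreasing.
    Letting chi approach the indicator function of an interval, and using the
    time continuity of the solution, m_k(t) <= m_k(0).  If S(., 0) >= s on
    [-r', r'], then m_k(0) is bounded independently of k; as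
    exp (k y) >= k max(0, y), this forces int a rho max(0, s - S) phi dx = 0 at
    time t, that is S(., t) >= s wherever phi > 0, in particular for |x| < r. *)

(** * Smooth test functions *)

Section flat.
Context {R : realType}.
Implicit Types (p : {poly R}) (x y : R).

(** The truncation max(0, s - S) would give the result at once, but it is constant for S > s and not
    twice differentiable, so it is not an admissible g. The exponentials g_k are admissible, and the
    uniform bound on m_k(0) lets them recover the truncation as k grows. The entropy inequality is
    tested only with smooth functions supported in t > 0. This forces the flat function f in place
    of sharp indicators, time cut-offs that start at a positive time, and a separate passage to time
    0. The L^infinity bounds hold for almost every (x, t) and so control no individual time; that
    passage rests instead on the L^1_loc continuity of the conserved variables and on the bound of a
    rho g_k(S) by a constant times a rho. *)

Definition flat p x : R := if 0 < x then p.[x^-1] * expR (- x^-1) else 0.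

Lemma flat_le0 p x : x <= 0 -> flat p x = 0.
Proof. by rewrite /flat leNgt; case: ifP. Qed.

Lemma flat_gt0 p x : 0 < x -> flat p x = p.[x^-1] * expR (- x^-1).
Proof. by rewrite /flat => ->. Qed.

(** One term of the exponential series is at most the whole sum. *)
Lemma exprM_expRN_le n y : 0 <= y -> y ^+ n.+1 * expR (- y) <= n.+1`!%:R.
Proof.
move=> y0; rewrite expRN ler_pdivrMr ?expR_gt0// -ler_pdivrMl; last first.
  by rewrite ltr0n fact_gt0.
rewrite mulrC (le_trans _ (expR_ge1Dxn n y0))// lerDr ler01//.
Qed.

Lemma horner_expRN_bounded p :
  exists C, forall y, 0 <= y -> `|p.[y]| * y ^+ 2 * expR (- y) <= C.
Proof.
exists (\sum_(i < size p) `|p`_i| * (i.+2)`!%:R) => y y0.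
rewrite -mulrA horner_coef.
apply: (@le_trans _ _ ((\sum_(i < size p) `|p`_i * y ^+ i|)
   * (y ^+ 2 * expR (- y)))).
  rewrite ler_wpM2r ?ler_norm_sum//.
  by rewrite mulr_ge0// ?expR_ge0// exprn_ge0.
rewrite mulr_suml; apply: ler_sum => i _.
rewrite normrM -mulrA ler_wpM2l// ger0_norm ?exprn_ge0//.
by rewrite mulrA -exprD addn2 exprM_expRN_le.
Qed.

(** With y = 1 / x, the factor y ^ 2 of the previous bound becomes x ^ (-2). Quadratic decay is what
    makes [flat p] differentiable at 0, with derivative 0. *)
Lemma flat_le_sqr p : exists C, forall x, `|flat p x| <= C * x ^+ 2.
Proof.
have [C HC] := horner_expRN_bounded p; exists C => x.
have C0 : 0 <= C by rewrite (le_trans _ (HC 0 _))// expr0n mulr0 mul0r.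
have [x0|x0] := leP x 0.
  by rewrite flat_le0// normr0 mulr_ge0 ?sqr_ge0.
rewrite flat_gt0// -ler_pdivrMr ?exprn_gt0// normrM.
rewrite (ger0_norm (expR_ge0 _)) mulrAC -exprVn.
by apply: HC; rewrite invr_ge0 ltW.
Qed.

(** For x > 0 the derivative is x ^ (-2) (p - p')(1 / x) exp (- 1 / x). The polynomial factor in
    [flat] is there so that the family is stable under differentiation. *)
Lemma is_derive_flat p x :
  is_derive x 1 (flat p) (flat ('X^2 * (p - p^`())) x).
Proof.
have [x0|x0|->] := ltgtP x 0.
- rewrite flat_le0 ?ltW//.
  apply: (@near_eq_is_derive _ _ _ (cst 0)) => //.
  near=> z; rewrite flat_le0//=; apply/ltW; near: z.
  exact: lt_nbhsl.
- rewrite flat_gt0//.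
  have x0' : x != 0 by rewrite gt_eqF.
  apply: (@near_eq_is_derive _ _ _
    ((horner p \o GRing.inv) * (expR \o (-%R \o GRing.inv)))) => //.
    near=> z; rewrite flat_gt0//=; near: z.
    exact: lt_nbhsr.
  have dV : is_derive x 1 (@GRing.inv R) (- x ^- 2).
    have := @is_deriveV _ id x 1 1 x0' (is_derive_id x 1).
    by rewrite [_ *: _]mulr1.
  have d1 : is_derive x 1 (horner p \o GRing.inv) (p^`().[x^-1] * - x ^- 2).
    exact: is_derive1_comp.
  have d2 : is_derive x 1 (expR \o (-%R \o GRing.inv))
      (expR (- x^-1) * (- 1 * - x ^- 2)).
    by apply: is_derive1_comp; exact: is_derive1_comp.
  have d3 := @is_deriveM _ _ _ _ _ _ _ _ d1 d2.
  apply: (is_derive_eq d3).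
  rewrite /= /GRing.scale/= hornerM hornerXn hornerD hornerN -!exprVn.
  ring.
- rewrite flat_le0//.
  have [C HC] := flat_le_sqr p.
  have H : h^-1 *: ((flat p \o shift 0) (h *: 1) - flat p 0)
      @[h --> 0^'] --> (0 : R).
    apply/cvgr0Pnorm_le => e e0; near=> h.
    have h0 : h != 0 by near: h; exact: nbhs_dnbhs_neq.
    rewrite /= addr0 [X in flat p X]mulr1 [flat p 0]flat_le0// subr0.
    rewrite normrM normfV ler_pdivrMl ?normr_gt0//.
    apply: (le_trans (HC h)).
    rewrite -normr_id -[X in _ * X]ger0_norm ?sqr_ge0// normrX.
    rewrite normr_id expr2 mulrCA ler_wpM2l//.
    (* The added 1 keeps the constant positive, since its inverse sets the size of the
       neighbourhood. *)
    apply: (@le_trans _ _ ((`|C| + 1) * `|h|)).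
      by rewrite ler_wpM2r// (le_trans (ler_norm _))// lerDl.
    rewrite -ler_pdivlMl; last by rewrite ltr_wpDl.
    near: h; apply: dnbhs0_le.
    by rewrite mulr_gt0// invr_gt0 ltr_wpDl.
  apply: DeriveDef; last exact: cvg_lim H.
  by apply/cvg_ex; exists 0.
Unshelve. all: by end_near. Qed.

End flat.

Section flat_generated.
Context {R : realType}.
Implicit Types (p : {poly R}) (k l c : R) (z v : R * R).

Definition linform (k l : R) z : R := k * z.1 + l * z.2.

Lemma is_diff_linform k l z : is_diff z (linform k l) (linform k l).
Proof.
have lin : linear (linform k l).
  by move=> a u v; rewrite /linform /GRing.scale/= /GRing.scale/=; ring.
pose linM := GRing.isLinear.Build _ _ _ _ _ lin.
pose linL : {linear _ -> _} := HB.pack (linform k l) linM.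
have cont : continuous linL.
  move=> y; apply: cvgD; apply: cvgM; try exact: cvg_cst.
  - exact: cvg_fst.
  - exact: cvg_snd.
have -> : linform k l = linL by [].
apply: DiffDef; first exact: linear_differentiable.
by rewrite diff_lin.
Qed.

(* Closed under directional derivatives, because the derivative of [flat p] is
   again of this form: this gives C^oo functions at once. *)
Inductive flat_generated : (R * R -> R) -> Prop :=
| flat_generated_flat p k l c :
    flat_generated (fun z => flat p (linform k l z + c))
| flat_generated_cst c : flat_generated (fun=> c)
| flat_generatedD f g : flat_generated f -> flat_generated g ->
    flat_generated (fun z => f z + g z)
| flat_generatedM f g : flat_generated f -> flat_generated g ->
    flat_generated (fun z => f z * g z)
| flat_generatedV f : flat_generated f -> (forall z, f z != 0) ->
    flat_generated (fun z => (f z)^-1).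

Lemma differentiable_affine (f : R -> R) k l c z :
  derivable f (linform k l z + c) 1 ->
  differentiable (fun z => f (linform k l z + c)) z.
Proof.
move=> df.
apply: (@differentiable_comp _ _ _ _ (fun z => linform k l z + c) f).
  apply: differentiableD => //.
  by case: (is_diff_linform k l z).
exact/derivable1_diffP.
Qed.

Lemma derive_affine (f : R -> R) k l c v z df :
  is_derive (linform k l z + c) 1 f df ->
  'D_v (fun z => f (linform k l z + c)) z = linform k l v * df.
Proof.
move=> [dvf fd]; rewrite deriveE; last exact: differentiable_affine.
have [dl ld] := is_diff_linform k l z.
have da : differentiable (fun z => linform k l z + c) z.
  exact: differentiableD.
rewrite (@diff_comp _ _ _ _ (fun z => linform k l z + c) f) => //; last first.
  exact/derivable1_diffP.
rewrite /= deriv1E// derive1E fd (@diffD _ _ _ _ (cst c))//.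
by rewrite diff_cst ld /= addr0.
Qed.

Lemma flat_generated_differentiable f z :
  flat_generated f -> differentiable f z.
Proof.
elim=> {f} [p k l c|c|f g _ df _ dg|f g _ df _ dg|f _ df f0].
- apply: differentiable_affine.
  by case: (is_derive_flat p (linform k l z + c)).
- exact: differentiable_cst.
- exact: differentiableD.
- exact: differentiableM.
- exact: differentiableV.
Qed.

Lemma flat_generated_derive f v :
  flat_generated f -> flat_generated ('D_v f).
Proof.
elim=> {f} [p k l c|c|f g sf df sg dg|f g sf df sg dg|f sf df f0].
- rewrite (_ : 'D_v _ = fun z => linform k l v *
    flat ('X^2 * (p - p^`())) (linform k l z + c)).
    by apply: flat_generatedM; [exact: flat_generated_cst|
      exact: flat_generated_flat].
  by apply/funext => z; apply: derive_affine; exact: is_derive_flat.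
- rewrite (_ : 'D_v _ = fun=> 0); first exact: flat_generated_cst.
  by apply/funext => z; exact: derive_cst.
- rewrite (_ : 'D_v _ = fun z => 'D_v f z + 'D_v g z).
    exact: flat_generatedD.
  by apply/funext => z; apply: deriveD; apply: diff_derivable;
    exact: flat_generated_differentiable.
- rewrite (_ : 'D_v _ = fun z => f z * 'D_v g z + g z * 'D_v f z).
    by apply: flat_generatedD; exact: flat_generatedM.
  by apply/funext => z; apply: deriveM; apply: diff_derivable;
    exact: flat_generated_differentiable.
(* The square of the inverse is spelled as a product of two inverses, so that the constructors of
   [flat_generated] apply. *)
- rewrite (_ : 'D_v _ = fun z => (-1 * ((f z)^-1 * (f z)^-1)) * 'D_v f z).
    apply: flat_generatedM => //; apply: flat_generatedM.
      exact: flat_generated_cst.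
    by apply: flat_generatedM; exact: flat_generatedV.
  apply/funext => z; rewrite deriveV//; last first.
    by apply: diff_derivable; exact: flat_generated_differentiable.
  by rewrite mulN1r -expr2 exprVn.
Qed.

Lemma flat_generated_smooth f : flat_generated f -> smooth_on setT f.
Proof.
move=> sf vs z _ /=; set g := foldr _ _ _.
have sg : flat_generated g.
  by rewrite /g; elim: vs {g} => //= v vs; exact: flat_generated_derive.
split; first exact/differentiable_continuous/flat_generated_differentiable.
by move=> v; exact/diff_derivable/flat_generated_differentiable.
Qed.

End flat_generated.

(** * Smooth steps in time and the densities obtained from them *)

Section step.
Context {R : realType}.
Implicit Types (x y a h t : R).

Local Notation f := (flat (1 : {poly R})).
Local Notation df := (flat ('X^2 : {poly R})).

Lemma is_derive_flat1 y : is_derive y 1 f (df y).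
Proof.
by have := is_derive_flat (1 : {poly R}) y; rewrite derivC subr0 mulr1.
Qed.

Lemma flat1_ge0 y : 0 <= f y.
Proof.
by rewrite /flat; case: ifP => // _; rewrite hornerC mul1r expR_ge0.
Qed.

Lemma flat1_gt0 y : 0 < y -> 0 < f y.
Proof. by move=> y0; rewrite flat_gt0// hornerC mul1r expR_gt0. Qed.

Lemma dflat1_ge0 y : 0 <= df y.
Proof.
rewrite /flat; case: ifP => // _.
by rewrite hornerXn mulr_ge0 ?expR_ge0 ?sqr_ge0.
Qed.

Lemma flat1_le x y : x <= y -> f x <= f y.
Proof.
move=> xy; have [x0|x0] := leP x 0; first by rewrite flat_le0// flat1_ge0.
have y0 := lt_le_trans x0 xy.
by rewrite !flat_gt0// !hornerC !mul1r ler_expR lerN2 lef_pV2.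
Qed.

Lemma continuous_flat p : continuous (flat (p : {poly R})).
Proof.
move=> x; apply: differentiable_continuous; apply/derivable1_diffP.
by case: (is_derive_flat p x).
Qed.

Lemma flat1D_gt0 y : 0 < f y + f (1 - y).
Proof.
have [y0|y0] := ltP 0 y; first by rewrite ltr_pwDl ?flat1_gt0 ?flat1_ge0.
by rewrite ltr_wpDl ?flat1_ge0// flat1_gt0//; lra.
Qed.

(** The standard smooth transition from 0 (for y <= 0) to 1 (for y >= 1). *)
Definition step y := f y / (f y + f (1 - y)).

(** The quotient rule for [step] after cancellation, in a form whose sign is visible. *)
Definition dstep y :=
  (df y * f (1 - y) + f y * df (1 - y)) / (f y + f (1 - y)) ^+ 2.

Lemma is_derive_step y : is_derive y 1 step (dstep y).
Proof.
have d1 := is_derive_flat1 y.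
have d2 : is_derive y 1 (fun y => f (1 - y)) (df (1 - y) * (0 - 1)).
  apply: (@is_derive1_comp _ f (fun y => 1 - y)); exact: is_derive_flat1.
have n0 : f y + f (1 - y) != 0 by rewrite gt_eqF// flat1D_gt0.
have d3 := @is_deriveV _ (fun y => f y + f (1 - y)) _ _ _ n0 (is_deriveD d1 d2).
have d4 := is_deriveM d1 d3.
apply: (is_derive_eq d4); rewrite /dstep /GRing.scale/=; field.
exact: n0.
Qed.

Lemma continuous_dstep : continuous dstep.
Proof.
move=> y.
have c1 p : (flat (p : {poly R}) (1 - z)) @[z --> y] --> flat p (1 - y).
  apply: (cvg_comp (fun z => 1 - z) (flat p) _ (@continuous_flat p (1 - y))).
  by apply: cvgB; [exact: cvg_cst|exact: cvg_id].
apply: cvgM.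
  by apply: cvgD; apply: cvgM => //; exact: continuous_flat.
apply: cvgV; first by rewrite expf_neq0// gt_eqF// flat1D_gt0.
by rewrite expr2; apply: cvgM; apply: cvgD => //; exact: continuous_flat.
Qed.

Lemma dstep_ge0 y : 0 <= dstep y.
Proof.
by rewrite divr_ge0 ?sqr_ge0// addr_ge0// mulr_ge0 ?flat1_ge0 ?dflat1_ge0.
Qed.

Lemma dstep_out y : y <= 0 \/ 1 <= y -> dstep y = 0.
Proof.
move=> [y0|y1]; rewrite /dstep.
  by rewrite !(@flat_le0 _ _ y)// !mul0r addr0 mul0r.
by rewrite !(@flat_le0 _ _ (1 - y)) ?subr_le0// !mulr0 addr0 mul0r.
Qed.

Lemma step_le0 y : y <= 0 -> step y = 0.
Proof. by move=> y0; rewrite /step flat_le0// mul0r. Qed.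

Lemma step_ge1 y : 1 <= y -> step y = 1.
Proof.
move=> y1; rewrite /step (@flat_le0 _ _ (1 - y)) ?subr_le0// addr0 divff//.
by rewrite gt_eqF// flat1_gt0// (lt_le_trans ltr01).
Qed.

Lemma step_le x y : x <= y -> step x <= step y.
Proof.
move=> xy; rewrite ler_pdivrMr ?flat1D_gt0// mulrAC ler_pdivlMr ?flat1D_gt0//.
rewrite !mulrDr [f x * f y]mulrC lerD2l.
by rewrite ler_pM ?flat1_ge0// flat1_le// lerD2l lerN2.
Qed.

(** The derivative of [step ((t - a) / h)]: a continuous probability density carried by [a, a + h].
    It lies to the right of a because only limits from the right are taken in time. *)
Definition weight a h t := h^-1 * dstep ((t - a) / h).

Lemma weight_ge0 a h t : 0 < h -> 0 <= weight a h t.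
Proof. by move=> h0; rewrite mulr_ge0 ?dstep_ge0// invr_ge0 ltW. Qed.

Lemma weight_out a h t : 0 < h -> ~~ (a <= t <= a + h) -> weight a h t = 0.
Proof.
move=> h0; rewrite negb_and -!ltNge => /orP[ta|ta].
  rewrite /weight dstep_out ?mulr0//; left.
  by rewrite pmulr_lle0 ?invr_gt0// subr_le0 ltW.
rewrite /weight dstep_out ?mulr0//; right.
by rewrite ler_pdivlMr// mul1r lerBrDl ltW.
Qed.

Lemma continuous_weight a h : continuous (weight a h).
Proof.
move=> t; apply: cvgM; first exact: cvg_cst.
apply: (cvg_comp (fun t => (t - a) / h) dstep _ (@continuous_dstep _)).
apply: cvgM; last exact: cvg_cst.
by apply: cvgB; [exact: cvg_id|exact: cvg_cst].
Qed.

(** Fundamental theorem of calculus: the primitive [step ((t - a) / h)] rises from 0 at a to 1 at a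
    + h. *)
Lemma integral_weight a h : 0 < h ->
  (\int[lebesgue_measure]_t (weight a h t)%:E = 1)%E.
Proof.
move=> h0.
transitivity
  (\int[lebesgue_measure]_(t in `[a, (a + h)%R]) (weight a h t)%:E)%E.
  rewrite [RHS]integral_mkcond; apply: eq_integral => t _; rewrite patchE.
  case: ifPn => //; rewrite notin_setE /= in_itv/= => /negP tah.
  by rewrite weight_out.
pose G t := step ((t - a) / h).
have dG t : is_derive t 1 G (weight a h t).
  rewrite /weight mulrC.
  have d1 : is_derive t 1 (fun t => (t - a) / h) (h^-1).
    have := @is_deriveM _ _ (fun t => t - a) (cst h^-1) t 1 _ _
      (is_deriveB (is_derive_id t 1) (is_derive_cst a t 1))
      (is_derive_cst h^-1 t 1).
    by move=> d; apply: (is_derive_eq d); rewrite /GRing.scale/=; ring.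
  exact: (is_derive1_comp (is_derive_step _) d1).
have cG : continuous G.
  move=> t; apply: differentiable_continuous; apply/derivable1_diffP.
  by case: (dG t).
rewrite (@continuous_FTC2 _ (weight a h) G).
- rewrite /G subrr mul0r (step_le0 (lexx 0)) addrAC subrr add0r.
  by rewrite divff ?gt_eqF// step_ge1// sube0.
- by rewrite ltrDl.
- exact/continuous_subspaceT/continuous_weight.
- split.
  + by move=> t _; case: (dG t).
  + exact/cvg_at_right_filter/cG.
  + exact/cvg_at_left_filter/cG.
- by move=> t _; rewrite derive1E; case: (dG t).
Qed.

End step.

(** * The shrinking cone and its time cut-off *)

Section cone.
Context {R : realType}.
Implicit Types (r L a b h : R) (z : R * R).

Local Notation f := (flat (1 : {poly R})).
Local Notation df := (flat ('X^2 : {poly R})).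

(** Here [r] is the radius at time 0, called r' in the overview. *)
Definition cone r L z : R :=
  f (linform (-1) (- L) z + r) * f (linform 1 (- L) z + r).

Lemma cone_ge0 r L z : 0 <= cone r L z.
Proof. by rewrite mulr_ge0 ?flat1_ge0. Qed.

Lemma flat1_le1 (y : R) : f y <= 1.
Proof.
have [y0|y0] := leP y 0; first by rewrite flat_le0.
by rewrite flat_gt0// hornerC mul1r expR_le1 oppr_le0 invr_ge0 ltW.
Qed.

Lemma cone_le1 r L z : cone r L z <= 1.
Proof. by rewrite mulr_ile1 ?flat1_ge0 ?flat1_le1. Qed.

Lemma cone_gt0 r L z : `|z.1| < r - L * z.2 -> 0 < cone r L z.
Proof.
rewrite ltr_norml => /andP[z1 z2].
by rewrite mulr_gt0// flat1_gt0// /linform; lra.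
Qed.

(** A coarse bound on the support, uniform in t >= 0: it yields compact supports and lets every
    spatial integral run over the same interval [- r, r]. *)
Lemma cone_eq0 r L z : 0 <= L -> 0 <= z.2 -> r < `|z.1| -> cone r L z = 0.
Proof.
move=> L0 z0 rz; have Lz : 0 <= L * z.2 by exact: mulr_ge0.
have [z1|z1] := leP 0 z.1.
  move: rz; rewrite ger0_norm// => rz.
  by rewrite /cone flat_le0 ?mul0r// /linform; lra.
move: rz; rewrite ltr0_norm// => rz.
by rewrite /cone mulrC flat_le0 ?mul0r// /linform; lra.
Qed.

Lemma flat_generated_cone r L : flat_generated (cone r L).
Proof. by apply: flat_generatedM; exact: flat_generated_flat. Qed.

Lemma continuous_cone r L : continuous (cone r L).
Proof.
by move=> z; apply/differentiable_continuous/flat_generated_differentiable/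
  flat_generated_cone.
Qed.

Lemma derive_cone r L v z : 'D_v (cone r L) z =
  f (linform (-1) (- L) z + r) *
    (linform 1 (- L) v * df (linform 1 (- L) z + r)) +
  f (linform 1 (- L) z + r) *
    (linform (-1) (- L) v * df (linform (-1) (- L) z + r)).
Proof.
have dA k l : 'D_v (fun z => f (linform k l z + r)) z =
    linform k l v * df (linform k l z + r).
  by apply: derive_affine; exact: is_derive_flat1.
have dd k l : derivable (fun z => f (linform k l z + r)) z v.
  by apply/diff_derivable/flat_generated_differentiable/flat_generated_flat.
by rewrite -2!dA; exact: deriveM.
Qed.

(** Each edge of the cone recedes at speed L. The transport derivative is -((L - u) f1 d2 + (L + u)
    f2 d1), where f1, f2 are the two factors and d1, d2 their profile derivatives, all nonnegative;
    |u| <= L gives the sign. *)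
Lemma cone_transport r L z (u : R) : `|u| <= L ->
  'D_(0, 1) (cone r L) z + u * 'D_(1, 0) (cone r L) z <= 0.
Proof.
rewrite ler_norml => /andP[u1 u2].
rewrite !derive_cone /linform/=.
set f1 := f _; set d2 := df _; set f2 := f _; set d1 := df _.
rewrite (_ : _ + _ = - ((f1 * d2) * (L - u) + (f2 * d1) * (L + u))); last ring.
rewrite oppr_le0 addr_ge0// mulr_ge0//; try lra.
  by rewrite mulr_ge0 ?flat1_ge0 ?dflat1_ge0.
by rewrite mulr_ge0 ?flat1_ge0 ?dflat1_ge0.
Qed.

(** A smooth substitute for the indicator of a time interval: it rises over [a, a + h] and falls
    over [b, b + h]. *)
Definition window a b h z : R := step ((z.2 - a) / h) - step ((z.2 - b) / h).

Lemma window_ge0 a b h z : a <= b -> 0 < h -> 0 <= window a b h z.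
Proof.
move=> ab h0; rewrite subr_ge0 step_le// ler_pM2r ?invr_gt0//.
by rewrite lerD2l lerN2.
Qed.

Lemma window_out a b h z : a <= b -> 0 < h -> ~~ (a <= z.2 <= b + h) ->
  window a b h z = 0.
Proof.
move=> ab h0; rewrite negb_and -!ltNge /window => /orP[za|zb].
  rewrite !step_le0 ?subrr// pmulr_lle0 ?invr_gt0//; lra.
rewrite !step_ge1 ?subrr// ler_pdivlMr// mul1r; lra.
Qed.

Lemma step_affineE a h : (fun z : R * R => step ((z.2 - a) / h)) =
  (fun z => step (linform 0 h^-1 z + - (a / h))).
Proof.
by apply/funext => z; rewrite /linform mul0r add0r; congr step; ring.
Qed.

Lemma flat_generated_step a h :
  flat_generated (fun z : R * R => step ((z.2 - a) / h)).
Proof.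
rewrite step_affineE /step.
apply: (@flat_generatedM _ (fun z => f (linform 0 h^-1 z + - (a / h)))).
  exact: flat_generated_flat.
apply: (@flat_generatedV _ (fun z => f (linform 0 h^-1 z + - (a / h)) +
  f (1 - (linform 0 h^-1 z + - (a / h))))) => [|z].
  apply: flat_generatedD; first exact: flat_generated_flat.
  rewrite (_ : (fun _ => _) =
    (fun z => f (linform 0 (- h^-1) z + (1 + a / h)))).
    exact: flat_generated_flat.
  by apply/funext => z; congr flat; rewrite /linform; ring.
by rewrite gt_eqF// flat1D_gt0.
Qed.

Lemma derive_step a h v z :
  'D_v (fun z : R * R => step ((z.2 - a) / h)) z = v.2 * weight a h z.2.
Proof.
rewrite step_affineE (derive_affine _ (is_derive_step _)) /linform /weight.
rewrite !mul0r !add0r (_ : (z.2 - a) / h = h^-1 * z.2 + - (a / h)); ring.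
Qed.

Lemma flat_generated_window a b h : flat_generated (window a b h).
Proof.
rewrite (_ : window a b h =
  (fun z => step ((z.2 - a) / h) + -1 * step ((z.2 - b) / h))).
  apply: flat_generatedD; first exact: flat_generated_step.
  by apply: flat_generatedM;
    [exact: flat_generated_cst|exact: flat_generated_step].
by apply/funext => z; rewrite mulN1r.
Qed.

Lemma derive_window a b h v z :
  'D_v (window a b h) z = v.2 * (weight a h z.2 - weight b h z.2).
Proof.
rewrite mulrBr -!derive_step; apply: deriveB;
  exact/diff_derivable/flat_generated_differentiable/flat_generated_step.
Qed.

Definition cone_test r L a b h z : R := window a b h z * cone r L z.

Lemma derive_cone_test r L a b h v z : 'D_v (cone_test r L a b h) z =
  window a b h z * 'D_v (cone r L) z +
  cone r L z * (v.2 * (weight a h z.2 - weight b h z.2)).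
Proof.
rewrite -derive_window; apply: deriveM;
  apply/diff_derivable/flat_generated_differentiable.
  exact: flat_generated_window.
exact: flat_generated_cone.
Qed.

(** The part where the cone is differentiated is nonpositive and is dropped. What remains is the
    derivative of the window, a bump at a minus a bump at b, which turns the entropy inequality into
    a comparison of two time averages. *)
Lemma cone_test_transport r L a b h z (u : R) :
  a <= b -> 0 < h -> `|u| <= L ->
  'D_(0, 1) (cone_test r L a b h) z + u * 'D_(1, 0) (cone_test r L a b h) z <=
  cone r L z * (weight a h z.2 - weight b h z.2).
Proof.
move=> ab h0 uL; rewrite 2!derive_cone_test.
have := mulr_ge0_le0 (window_ge0 z ab h0) (cone_transport r z uL).
move: ('D_(_) (cone r L) z) ('D_(_) (cone r L) z) (window a b h z) => Dt Dx W H.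
rewrite mul0r mulr0 addr0 mul1r mulrCA addrAC -mulrDr.
by rewrite gerDr.
Qed.

Lemma cone_test_ge0 r L a b h z : a <= b -> 0 < h -> 0 <= cone_test r L a b h z.
Proof. by move=> ab h0; rewrite mulr_ge0 ?window_ge0 ?cone_ge0. Qed.

(** The support must lie in t > 0, hence 0 < a; time 0 is reached later, by continuity. *)
Lemma test_function_cone_test r L a b h : 0 <= L -> 0 < a -> a <= b -> 0 < h ->
  test_function (cone_test r L a b h).
Proof.
move=> L0 a0 ab h0; split.
  apply: flat_generated_smooth; apply: flat_generatedM.
    exact: flat_generated_window.
  exact: flat_generated_cone.
exists (`[- r, r]%classic `*` `[a, b + h]%classic); split.
- by apply: compact_setX; exact: segment_compact.
- move=> z [_] /=; rewrite in_itv/= => /andP[az _].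
  exact: lt_le_trans az.
- move=> z; rewrite /setX/= !in_itv/= -ler_norml => /not_andP[zr|/negP zab].
    have [za|za] := boolP (a <= z.2 <= b + h); last first.
      by rewrite /cone_test window_out// mul0r.
    rewrite /cone_test cone_eq0 ?mulr0//.
      by case/andP: za => + _; apply: le_trans; exact: ltW.
    by rewrite ltNge; exact/negP.
  by rewrite /cone_test window_out// mul0r.
Qed.

End cone.

Section test_function_bound.
Context {R : realType}.

Definition square (r : R) : set (measurableTypeR R * measurableTypeR R) :=
  `[- r, r]%classic `*` `[- r, r]%classic.

Definition square_bounded (f : R * R -> R) :=
  exists r C : R, [/\ 0 <= r, 0 <= C &
    forall z, `|f z| <= C * \1_(square r) z].

(** Off the closed set K the function is locally 0, so its derivative vanishes there; on a square
    containing K the extreme value theorem gives the bound. *)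
Lemma derive_test_function (th : R * R -> R) v : test_function th ->
  continuous ('D_v th) /\ square_bounded ('D_v th).
Proof.
move=> [sth [K [cK _ K0]]].
have cD : continuous ('D_v th) by move=> z; case: (sth [:: v] z I).
split => //.
have cntK : closed K by apply: compact_closed => //; exact: norm_hausdorff.
have D0 z : ~ K z -> 'D_v th z = 0.
  move=> Kz; rewrite -(@derive_cst _ _ _ (0 : R) z v).
  apply: near_eq_derive.
  have : nbhs z (~` K).
    by apply: open_nbhs_nbhs; split => //; exact: closed_openC.
  by apply: filterS => y /= Ky; rewrite K0.
have [r0 [_ Kr]] := compact_bounded cK.
(* Boundedness of K is stated for radii strictly above [r0]. *)
pose r := `|r0| + 1.
have rge0 : 0 <= r by rewrite addr_ge0.
pose B := square r.
have KB : K `<=` B.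
  move=> z Kz.
  have : `|z| <= r by apply: Kr Kz; rewrite ltr_pwDr ?ler_norm.
  rewrite prod_normE ge_max => /andP[z1 z2].
  by split; rewrite /= in_itv/= -ler_norml.
have cB : compact B by apply: compact_setX; exact: segment_compact.
have B0 : B !=set0 by exists 0; split; rewrite /= in_itv/= oppr_le0 rge0.
have [|c _ Hc] := @compact_EVT_max _ _ (fun z => `|'D_v th z|) B B0 cB.
  apply: continuous_subspaceT => z.
  by apply: cvg_norm; exact: cD.
exists r, `|'D_v th c|; split => // z; rewrite indicE.
have [zB|zB] := boolP (z \in B).
  by rewrite mulr1 Hc.
rewrite mulr0 D0 ?normr0// => /KB; move: zB; rewrite notin_setE; exact.
Qed.

End test_function_bound.

(** * Measurability and integration on the half plane *)

Section measurable_plane.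
Context {R : realType}.

(** The sigma-algebra here is the product one, so U is exhibited as the countable union of the boxes
    inside it that have rational centres and radii 1 / (n + 1). Codes of other boxes, or of none,
    contribute the empty set. *)
Lemma open_measurable2 (U : set (R * R)) : open U -> measurable U.
Proof.
move=> oU.
pose box (w : rat * rat * nat) : set (R * R) :=
  ball (ratr w.1.1 : R) (w.2.+1%:R^-1) `*` ball (ratr w.1.2 : R) (w.2.+1%:R^-1).
pose F n : set (R * R) :=
  if unpickle n is Some w then (if `[< box w `<=` U >] then box w else set0)
  else set0.
have -> : U = \bigcup_n F n.
  apply/seteqP; split => [z Uz|z [n _]]; last first.
    rewrite /F; case: unpickle => // w; case: ifPn => // /asboolP; exact.
  have /nbhs_ballP[e/= e0 eU] : nbhs z U by exact: open_nbhs_nbhs.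
  have [n ne] : exists n : nat, n.+1%:R^-1 < e / 2.
    exists (Num.truncn (e / 2)^-1).
    rewrite -[X in _ < X]invrK ltf_pV2 ?posrE ?invr_gt0 ?divr_gt0//.
    exact: truncnS_gt.
  have n0 : 0 < n.+1%:R^-1 :> R by rewrite invr_gt0.
  have near x : exists q : rat, ball (ratr q : R) n.+1%:R^-1 (x : R).
    have [|q] := @rat_in_itvoo R x (x + n.+1%:R^-1); first by rewrite ltrDl.
    rewrite in_itv/= => /andP[xq qx]; exists q.
    by rewrite /ball/= gtr0_norm ?subr_gt0// ltrBlDl.
  have [[p xp] [q yq]] := (near z.1, near z.2).
  have bU : box (p, q, n) `<=` U.
    apply: subset_trans eU => w [wp wq]; rewrite [e]splitr.
    have lt := ltW ne.
    split; apply: (le_ball (lerD lt lt));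
      apply: (@ball_triangle _ _ _ _ _ n.+1%:R^-1 n.+1%:R^-1) => //.
    - exact: ball_sym xp.
    - exact: wp.
    - exact: ball_sym yq.
    - exact: wq.
  have [k kE] : exists k, unpickle k = Some (p, q, n).
    by exists (pickle (p, q, n)); rewrite pickleK.
  exists k; first exact: I.
  by rewrite /F kE; case: ifPn => [_|/asboolPn//]; split.
apply: bigcupT_measurable => n; rewrite /F.
case: unpickle => // w; case: ifP => // _.
by apply: measurableX; exact: measurable_ball.
Qed.

(** Made for the entropy, which is continuous only on an open set O of states: the part of O where h
    > y is open, hence measurable. *)
Lemma measurable_fun_comp_continuous d (T : measurableType d) (A : set T)
    (f g : T -> R) (O : set (R * R)) (h : R * R -> R) :
  measurable A -> measurable_fun A f -> measurable_fun A g ->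
  open O -> (forall z, O z -> {for z, continuous h}) ->
  (forall x, A x -> O (f x, g x)) ->
  measurable_fun A (fun x => h (f x, g x)).
Proof.
move=> mA mf mg oO ch AO.
have mfg : measurable_fun A (fun x => (f x, g x)).
  apply: (measurability _ (measurable_prod_measurableType _ _)) => //.
  move=> _ [_ [B mB] [C mC <-] <-].
  have -> : A `&` (fun x => (f x, g x)) @^-1` (B `*` C) =
      (A `&` f @^-1` B) `&` (A `&` g @^-1` C).
    by apply/seteqP; split => [x [Ax []]|x [[Ax ?] [_ ?]]].
  by apply: measurableI; [exact: mf|exact: mg].
apply: (measurability _ (RGenOInfty.measurableE R)) => //.
move=> _ [_ [y ->] <-].
have oU : open (O `&` h @^-1` `]y, +oo[%classic).
  rewrite openE => z [Oz hz]; rewrite /interior.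
  apply: filterI; first exact: open_nbhs_nbhs.
  apply: ch => //; apply: open_nbhs_nbhs; split => //=.
have -> : A `&` (fun x => h (f x, g x)) @^-1` `]y, +oo[%classic =
  A `&` (fun x => (f x, g x)) @^-1` (O `&` h @^-1` `]y, +oo[%classic).
  by apply/seteqP; split => x [Ax] /=;
    [split => //; split => //; exact: AO|case].
by apply: mfg => //; exact: open_measurable2.
Qed.

Lemma continuous_measurable2 (h : R * R -> R) :
  continuous h -> measurable_fun setT h.
Proof.
move=> ch.
have -> : h = (fun z => h (z.1, z.2)) by apply/funext => -[].
apply: (@measurable_fun_comp_continuous _ _ _ fst snd setT h) => //.
- exact: openT.
- by move=> z _; exact: ch.
Qed.

End measurable_plane.

Section integration.
Context {R : realType}.

(** The integrands may change sign, so integrability is assumed in place of nonnegativity; the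
    exceptional null set is removed from the domain. *)
Lemma ae_le_integral d (T : measurableType d)
    (mu : {measure set T -> \bar R}) (D : set T) (f g : T -> \bar R) :
  measurable D -> mu.-integrable D f -> mu.-integrable D g ->
  {ae mu, forall x, D x -> (f x <= g x)%E} ->
  (\int[mu]_(x in D) f x <= \int[mu]_(x in D) g x)%E.
Proof.
move=> mD intf intg [N [mN N0 fgN]].
rewrite (negligible_integral mN mD intf N0) (negligible_integral mN mD intg N0).
apply: le_integral; first exact: measurableD.
- by apply: integrableS intf => //; exact: measurableD.
- by apply: integrableS intg => //; exact: measurableD.
- move=> x; rewrite inE => -[Dx Nx].
  by apply: contrapT => fg; apply: Nx; apply: fgN => /=; exact/not_implyP.
Qed.

Local Notation HP := (@half_plane R).

Lemma measurable_half_plane :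
  measurable (HP : set (measurableTypeR R * measurableTypeR R)).
Proof.
have -> : HP = setT `*` `]0, +oo[%classic.
  by apply/seteqP; split => z /=; rewrite in_itv/= andbT => //; case.
exact: measurableX.
Qed.

Lemma measurable_square (r : R) : measurable (square r).
Proof. exact: measurableX. Qed.

Lemma square_finite (r : R) : (@lebesgue2 R (square r) < +oo)%E.
Proof.
have -> : @lebesgue2 R (square r) =
    (@lebesgue_measure R `[(- r)%R, r] * @lebesgue_measure R `[(- r)%R, r])%E.
  exact: product_measure1E.
rewrite !lebesgue_measure_itv/=.
by case: ifP => _; rewrite ?mule0 ?ltry// -!EFinD -EFinM ltry.
Qed.

Lemma integrable_half_plane_bounded (r C : R) (f : R * R -> R) :
  measurable_fun HP f ->
  {ae @lebesgue2 R, forall z, HP z -> `|f z| <= C * \1_(square r) z} ->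
  (@lebesgue2 R).-integrable HP (EFin \o f).
Proof.
move=> mf fC; apply/integrableP; split; first exact/measurable_EFinP.
have mH := measurable_half_plane.
apply: (@le_lt_trans _ _
    (\int[@lebesgue2 R]_(z in HP) (`|C| * \1_(square r) z)%:E)%E).
  apply: ae_ge0_le_integral => //=.
  - by apply/measurable_EFinP; apply: measurableT_comp.
  - apply/measurable_EFinP; apply: measurable_funM => //.
    exact: measurable_indic (measurable_square r).
  - have [N [mN N0 fN]] := fC; exists N; split => //.
    apply: subset_trans fN; apply: subsetC => z + Hz => /(_ Hz).
    rewrite lee_fin => /le_trans; apply.
    by rewrite ler_wpM2r// ler_norm.
under eq_integral do rewrite EFinM.
rewrite ge0_integralZl//=; last first.
  by apply/measurable_EFinP; exact: measurable_indic (measurable_square r).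
rewrite integral_indic//; last exact: measurable_square.
rewrite lte_mul_pinfty//.
apply: le_lt_trans (square_finite r); apply: le_measure; rewrite ?inE//.
- by apply: measurableI => //; exact: measurable_square.
- exact: measurable_square.
Qed.

End integration.

(** * Integrating the entropy inequality over shrinking cones *)

(** The L^infinity norm unfolds to an essential supremum only on a space of positive measure. *)
Lemma lebesgue2_setT_gt0 {R : realType} : (0 < @lebesgue2 R setT)%E.
Proof.
have sq : (0 < @lebesgue2 R (square 1))%E.
  have -> : @lebesgue2 R (square 1) =
      (@lebesgue_measure R `[(- 1)%R, 1%R] *
       @lebesgue_measure R `[(- 1)%R, 1%R])%E.
    exact: product_measure1E.
  rewrite !lebesgue_measure_itv/= lte_fin ltrNl (lt_le_trans (ltrN10 _))//.
  by rewrite -EFinD -EFinM lte_fin opprK mulr_gt0.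
apply: (lt_le_trans sq); apply: le_measure => //; rewrite ?inE //.
exact: measurable_square.
Qed.

Section flow_facts.
Context {R : realType} (E : eos R) (D : set (R * R)) (F : flow R).
Implicit Types (t x : R) (z : R * R).

Local Notation HP := (@half_plane R).
Local Notation CHP := [set z : R * R | 0 <= z.2].

Definition eos_states : set (R * R) := @inv_fst R @^-1` eos_dom E.

Lemma eos_states_gt0 z : eos_states z -> 0 < z.1.
Proof. by move=> /eos_dom_gt0 /=; rewrite invr_gt0. Qed.

(** [inv_fst] is continuous away from zero density, and states of the preimage have positive
    density. *)
Lemma open_eos_states : open eos_states.
Proof.
rewrite openE => z Oz; have z0 := eos_states_gt0 Oz.
have : (x.1^-1, x.2) @[x --> z] --> (z.1^-1, z.2).
  apply: (@cvg_pair _ _ _ (nbhs z) (nbhs z.1^-1) (nbhs z.2)).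
    by apply: cvgV; [rewrite gt_eqF|exact: cvg_fst].
  exact: cvg_snd.
move=> cz; apply: (cz (eos_dom E)); apply: open_nbhs_nbhs.
by split => //; exact: eos_dom_open.
Qed.

Lemma continuous_entropy z : eos_states z -> {for z, continuous (entropy E)}.
Proof. by move=> Oz; case: (entropy_smooth [::] Oz). Qed.

Lemma measurable_closed_half_plane :
  measurable (CHP : set (measurableTypeR R * measurableTypeR R)).
Proof.
have -> : CHP = setT `*` `[0, +oo[%classic.
  by apply/seteqP; split => z /=; rewrite in_itv/= andbT => //; case.
exact: measurableX.
Qed.

Lemma measurable_slice (f : R * R -> R) t : 0 <= t ->
  measurable_fun CHP f -> measurable_fun setT (fun x => f (x, t)).
Proof.
move=> t0 mf.
apply: (@measurable_comp _ _ _ _ _ _ CHP f setT (fun x => (x, t))) => //.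
- exact: measurable_closed_half_plane.
- by move=> _ [x _ <-].
Qed.

Context (SD : state_domain E D)
  (phys : physical D F).

Lemma flow_eos_states x t : 0 <= t ->
  eos_states (density F (x, t), energy F (x, t)).
Proof.
by move=> t0; have [DE _ _] := SD; have [_ _ FD _ _] := phys; exact/DE/FD.
Qed.

Lemma flow_entropy_bounded :
  exists M, forall x t, 0 <= t -> `|flow_entropy E F (x, t)| <= M.
Proof.
have [_ _ [M SM]] := SD; have [_ _ FD _ _] := phys.
exists M => x t t0; have := SM _ (FD x t t0).
by rewrite /inv_fst /= invrK.
Qed.

Lemma measurable_flow_entropy : measurable_fun CHP (flow_entropy E F).
Proof.
have [_ _ _ _ [mr mu me]] := phys.
apply: (measurable_fun_comp_continuous measurable_closed_half_plane mr me
  open_eos_states).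
- exact: continuous_entropy.
- by move=> -[x t] /= t0; exact: flow_eos_states.
Qed.

Definition flow_eta (g : R -> R) z : R :=
  cross_section F z.1 * density F z * g (flow_entropy E F z).

Lemma measurable_flow_eta g : measurable_fun setT g ->
  measurable_fun CHP (flow_eta g).
Proof.
move=> mg; have [_ _ _ ma [mr _ _]] := phys.
apply: measurable_funM; first apply: measurable_funM => //.
- apply: (measurable_comp (F := setT)) => //.
  exact: measurable_funTS.
- apply: (measurable_comp (F := setT)) => //.
  exact: measurable_flow_entropy.
Qed.

Lemma Linfty_norm_bound (f : R * R -> R) : (Linfty_norm f < +oo)%E ->
  {ae @lebesgue2 R, forall z, HP z -> `|f z| <= fine (Linfty_norm f)}.
Proof.
have l2 := lebesgue2_setT_gt0.
rewrite /Linfty_norm unlock /Lnorm l2 => fy.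
set f' := EFin \o _; set s := ess_sup _ _.
have s0 : (0 <= s)%E.
  by apply: ess_sup_gee; [exact: l2|apply: aeW => z; exact: abse_ge0].
have [N [mN N0 fN]] := @ess_sup_ge _ _ _ (@lebesgue2 R) (abse \o f').
exists N; split => //; apply: subset_trans fN; apply: subsetC => z /= + Hz.
rewrite -/s /f' /= patchE mem_set// -lee_fin fineK//.
by rewrite ge0_fin_numE.
Qed.

End flow_facts.

Section window_inequality.
Context {R : realType}.
Implicit Types (a h t r L C : R) (eta : R * R -> R).

Lemma weight_bounded a h : exists C, forall t, weight a h t <= C.
Proof.
have [|c _ cmax] := @compact_EVT_max _ _ (@dstep R) `[0, 1]%classic _
    (@segment_compact _ _ _) (continuous_subspaceT (@continuous_dstep R)).
  by exists 0; rewrite /= in_itv/= lexx ler01.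
have dC y : dstep y <= dstep c.
  have [y01|] := boolP (0 <= y <= 1).
    by apply: cmax; rewrite inE /= in_itv.
  rewrite negb_and -!ltNge => /orP yo; rewrite dstep_out ?dstep_ge0//.
  by case: yo => /ltW; [left|right].
exists (`|h^-1| * dstep c) => t.
rewrite (le_trans (ler_norm _))// normrM ler_wpM2l//.
by rewrite ger0_norm ?dstep_ge0.
Qed.

(** A null set N of the line lifts to the strip N x R, of measure 0 * +oo = 0. *)
Lemma ae_fst (P : R -> Prop) : {ae @lebesgue_measure R, forall x, P x} ->
  {ae @lebesgue2 R, forall z, P z.1}.
Proof.
move=> [N [mN N0 PN]]; exists (N `*` setT); split.
- exact: measurableX.
- have -> : @lebesgue2 R (N `*` setT) =
      (@lebesgue_measure R N * @lebesgue_measure R setT)%E.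
    exact: product_measure1E.
  by rewrite N0 mul0e.
- by move=> z /= Pz; split => //; exact: PN.
Qed.

Local Notation HP := (@half_plane R).
Local Notation mu := (@lebesgue_measure R).

(** For [eta] = a rho g_k(S) this is m_k(t); the fixed domain loses nothing for t >= 0 and L >= 0,
    by [cone_eq0]. *)
Definition cone_mass eta r L t : \bar R :=
  (\int[mu]_(x in `[(- r)%R, r]) (eta (x, t) * cone r L (x, t))%:E)%E.

Definition cone_density eta r L a h (z : R * R) : R :=
  eta z * cone r L z * weight a h z.2.

Lemma cone_density_ge0 eta r L a h z : 0 <= eta z -> 0 < h ->
  0 <= cone_density eta r L a h z.
Proof.
move=> e0 h0; apply: mulr_ge0; last exact: weight_ge0.
by apply: mulr_ge0 => //; exact: cone_ge0.
Qed.

Lemma measurable_cone r L : measurable_fun setT (cone r L).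
Proof. by apply: continuous_measurable2; exact: continuous_cone. Qed.

Lemma measurable_weight_snd a h :
  measurable_fun setT (fun z : R * R => weight a h z.2).
Proof.
apply: continuous_measurable2 => z.
by apply: (cvg_comp snd); [exact: cvg_snd|exact: continuous_weight].
Qed.

Lemma measurable_cone_density eta r L a h : measurable_fun HP eta ->
  measurable_fun HP (cone_density eta r L a h).
Proof.
move=> meta; apply: measurable_funM.
  apply: measurable_funM => //; apply: measurable_funTS.
  exact: measurable_cone.
by apply: measurable_funTS; exact: measurable_weight_snd.
Qed.

Lemma cone_density_integrable eta r L a h C :
  measurable_fun HP eta -> 0 <= L -> 0 < h ->
  {ae @lebesgue2 R, forall z, HP z -> `|eta z| <= C} ->
  (@lebesgue2 R).-integrable HP (EFin \o cone_density eta r L a h).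
Proof.
move=> meta L0 h0 [N [mN N0 etaN]].
have [B wB] := weight_bounded a h.
(* The square of half-side q contains [- r, r] x [a, a + h], outside of which the density vanishes
   on the half plane. *)
pose q := `|r| + `|a| + h.
apply: (@integrable_half_plane_bounded _ q (`|C| * `|B|)).
  exact: measurable_cone_density.
exists N; split => //; apply: subset_trans etaN; apply: subsetC => z /= + Hz.
move=> /(_ Hz) etaC; rewrite /cone_density.
have [tah|tah] := boolP (a <= z.2 <= a + h); last first.
  by rewrite weight_out// mulr0 normr0 !mulr_ge0.
have [zr|zr] := leP `|z.1| r; last first.
  by rewrite cone_eq0 ?(ltW Hz)// mulr0 mul0r normr0 !mulr_ge0.
rewrite indicE mem_set ?mulr1.
  have c1 : `|cone r L z| <= 1 by rewrite ger0_norm ?cone_ge0 ?cone_le1.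
  have w1 : `|weight a h z.2| <= `|B|.
    by rewrite ger0_norm ?weight_ge0// (le_trans (wB _))// ler_norm.
  rewrite (normrM (_ * _)) (normrM (eta z)); apply: ler_pM => //.
  rewrite -[leRHS]mulr1; apply: ler_pM => //.
  exact: le_trans etaC (ler_norm C).
have a0 := ler_norm a; have r0 := ler_norm r; have r1 := normr_ge0 r.
have a1 := normr_ge0 a.
have : -`|a| <= a by rewrite lerNl -normrN ler_norm.
move: tah => /andP[t1 t2] a2.
split; rewrite /= in_itv/= -ler_norml.
  by rewrite (le_trans zr)// /q -addrA (le_trans r0)// lerDl addr_ge0// ltW.
by rewrite ler_norml /q; apply/andP; split; lra.
Qed.

(** The right-hand side is the inner integral of Tonelli's theorem on the whole plane, for the
    density extended by 0. For t <= 0, where [eta] is not controlled, both sides vanish because 0 <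
    a. *)
Lemma weighted_cone_massE eta r L a h t :
  measurable_fun [set z : R * R | 0 <= z.2] eta ->
  0 <= L -> 0 < a -> 0 < h -> (forall z, HP z -> 0 <= eta z) ->
  ((weight a h t)%:E * cone_mass eta r L t =
   fubini_G mu ((fun z => (cone_density eta r L a h z)%:E) \_ HP) t)%E.
Proof.
move=> cmeta L0 a0 h0 eta0; rewrite /fubini_G.
have [t0|t0] := leP t 0.
  rewrite weight_out ?mul0e//; last first.
    by rewrite negb_and -ltNge (le_lt_trans t0).
  apply/esym/integral0_eq => x _; rewrite patchE ifN// notin_setE /=.
  by rewrite /half_plane/= ltNge t0.
rewrite /cone_mass -ge0_integralZl//=; last 3 first.
- apply/measurable_EFinP; apply: measurable_funTS; apply: measurable_funM.
    exact: measurable_slice (ltW t0) cmeta.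
  apply: measurable_slice (ltW t0) _; apply: measurable_funTS.
  exact: measurable_cone.
- move=> x _; rewrite lee_fin; apply: mulr_ge0; last exact: cone_ge0.
  exact: eta0.
- by rewrite lee_fin weight_ge0.
rewrite [LHS]integral_mkcond; apply: eq_integral => x _.
have Hxt : (x, t) \in HP by rewrite inE.
rewrite !patchE Hxt.
case: ifPn => [_|]; first by rewrite -EFinM /cone_density /= mulrC.
rewrite notin_setE /= in_itv/= -ler_norml => /negP; rewrite -ltNge => xr.
by rewrite /cone_density cone_eq0 ?(ltW t0)// mulr0 mul0r.
Qed.

Lemma measurable_half_planeS eta :
  measurable_fun [set z : R * R | 0 <= z.2] eta -> measurable_fun HP eta.
Proof.
apply: measurable_funS; first exact: measurable_closed_half_plane.
by move=> z; exact: ltW.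
Qed.

Lemma measurable_cone_density_restrict eta r L a h : measurable_fun HP eta ->
  measurable_fun setT ((fun z => (cone_density eta r L a h z)%:E) \_ HP).
Proof.
move=> meta; apply/(measurable_restrictT _ (@measurable_half_plane R)).
by apply/measurable_EFinP; exact: measurable_cone_density.
Qed.

Lemma cone_density_restrict_ge0 eta r L a h : 0 < h ->
  (forall z, HP z -> 0 <= eta z) ->
  forall z, (0 <= ((fun z => (cone_density eta r L a h z)%:E) \_ HP) z)%E.
Proof.
move=> h0 eta0 z; rewrite patchE; case: ifPn => // /set_mem Hz.
by rewrite lee_fin cone_density_ge0// eta0.
Qed.

Lemma measurable_weighted_cone_mass eta r L a h :
  measurable_fun [set z : R * R | 0 <= z.2] eta ->
  0 <= L -> 0 < a -> 0 < h -> (forall z, HP z -> 0 <= eta z) ->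
  measurable_fun setT (fun t => (weight a h t)%:E * cone_mass eta r L t)%E.
Proof.
move=> cmeta L0 a0 h0 eta0.
have meta := measurable_half_planeS cmeta.
under eq_fun do rewrite weighted_cone_massE//.
apply: measurable_fun_fubini_tonelli_G.
  exact: measurable_cone_density_restrict.
exact: cone_density_restrict_ge0.
Qed.

Lemma integral_cone_density eta r L a h :
  measurable_fun [set z : R * R | 0 <= z.2] eta ->
  0 <= L -> 0 < a -> 0 < h -> (forall z, HP z -> 0 <= eta z) ->
  (\int[@lebesgue2 R]_(z in HP) (cone_density eta r L a h z)%:E =
   \int[mu]_t ((weight a h t)%:E * cone_mass eta r L t))%E.
Proof.
move=> cmeta L0 a0 h0 eta0.
have meta := measurable_half_planeS cmeta.
rewrite integral_mkcond/=.
under [RHS]eq_integral do rewrite weighted_cone_massE//.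
apply: fubini_tonelli2; first exact: measurable_cone_density_restrict.
exact: cone_density_restrict_ge0.
Qed.

End window_inequality.

Section window_mass.
Context {R : realType} (E : eos R) (D : set (R * R)) (F : flow R).
Local Notation HP := (@half_plane R).
Local Notation mu := (@lebesgue_measure R).
Local Notation L := (fine (Linfty_norm (velocity F))).

Lemma flow_eta_ge0 (g : R -> R) z : physical D F -> (forall s, 0 <= g s) ->
  0 <= z.2 -> 0 <= flow_eta E F g z.
Proof.
move=> [a0 r0 _ _ _] g0 z0; apply: mulr_ge0 => //; apply: mulr_ge0.
  exact/ltW/a0.
by rewrite (surjective_pairing z); exact/ltW/r0.
Qed.

Lemma flow_eta_bounded (g : R -> R) B : physical D F -> bounded_flow E F ->
  (forall s, 0 <= g s) ->
  (forall x t, 0 <= t -> g (flow_entropy E F (x, t)) <= B) ->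
  exists C, {ae @lebesgue2 R, forall z, HP z -> `|flow_eta E F g z| <= C}.
Proof.
move=> phys [rb _ _ _ ab] g0 gB; have [a0 r0 _ _ _] := phys.
have [N [mN N0 rN]] := Linfty_norm_bound rb.
have : {ae mu, forall x, cross_section F x <=
    fine ('N[mu]_+oo[EFin \o cross_section F])%E}.
  have n0 := Lnorm_ge0 mu +oo%E (EFin \o cross_section F).
  (* The essential supremum appears once the line is known to have positive measure, as [0, 1]
     shows. *)
  move: ab n0; rewrite unlock /Lnorm; case: ifPn => [_ ab n0|]; last first.
    rewrite -leNgt => mu0; exfalso; move: mu0; apply/negP; rewrite -ltNge.
    apply: (@lt_le_trans _ _ (mu `[0, 1]%classic)).
      by rewrite lebesgue_measure_itv/= lte_fin ltr01 -EFinD lte_fin subr0.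
    by apply: le_measure; rewrite ?inE.
  apply: filterS (ess_sup_ge mu _) => x /=.
  rewrite -lee_fin fineK ?ge0_fin_numE//; apply: le_trans.
  by rewrite lee_fin ler_norm.
move=> /ae_fst[N' [mN' N0' aN']].
set A := fine _ in aN'; set Cr := fine _ in rN.
exists (`|A| * `|Cr| * `|B|); exists (N `|` N'); split.
- exact: measurableU.
- by rewrite (measureU0 mN mN' N0').
- move=> z; apply: contra_notP => /not_orP[zN zN'] Hz.
  have {}zN : `|density F z| <= Cr.
    by apply: contrapT => H; apply: zN; apply: rN => /= /(_ Hz).
  have {}zN' : cross_section F z.1 <= A.
    by apply: contrapT => H; apply: zN'; exact: aN'.
  rewrite /flow_eta !normrM.
  apply: ler_pM => //; last first.
    rewrite ger0_norm// (le_trans _ (ler_norm B))//.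
    rewrite [z in flow_entropy _ _ z]surjective_pairing.
    by apply: gB; exact: ltW.
  apply: ler_pM => //; last exact: le_trans zN (ler_norm _).
  by rewrite gtr0_norm// (le_trans zN')// ler_norm.
Qed.

Lemma flux_integrable (eta u dt dx : R * R -> R) (C K : R) :
  measurable_fun HP u -> measurable_fun HP eta ->
  {ae @lebesgue2 R, forall z, HP z -> `|eta z| <= C} ->
  {ae @lebesgue2 R, forall z, HP z -> `|u z| <= K} ->
  continuous dt -> square_bounded dt -> continuous dx -> square_bounded dx ->
  (@lebesgue2 R).-integrable HP
    (EFin \o (fun z => eta z * (dt z + u z * dx z))).
Proof.
move=> mu' meta [N' [mN' N0' etaN']] [N [mN N0 uN]].
move=> cDt [r1 [C1 [r10 C10 Dt1]]] cDx [r2 [C2 [r20 C20 Dx2]]].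
apply: (@integrable_half_plane_bounded _ (r1 + r2) (`|C| * (C1 + K * C2))).
  apply: measurable_funM => //; apply: measurable_funD.
    by apply: measurable_funTS; exact: continuous_measurable2.
  apply: measurable_funM => //.
  by apply: measurable_funTS; exact: continuous_measurable2.
exists (N `|` N'); split.
- exact: measurableU.
- by rewrite (measureU0 mN mN' N0').
move=> z; apply: contra_notP => /not_orP[zN zN'] Hz.
have {}zN : `|u z| <= K.
  by apply: contrapT => H; apply: zN; apply: uN => /= /(_ Hz).
have {}zN' : `|eta z| <= C.
  by apply: contrapT => H; apply: zN'; apply: etaN' => /= /(_ Hz).
rewrite normrM -mulrA; apply: ler_pM => //.
  exact: le_trans zN' (ler_norm C).
have sub r3 r4 : 0 <= r3 -> 0 <= r4 -> r3 <= r4 ->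
    \1_(square r3) z <= \1_(square r4) z :> R.
  move=> r30 r40 r34; rewrite !indicE.
  have [|_] := boolP (z \in square r3).
    rewrite !inE => -[]; rewrite /= !in_itv/= -!ler_norml => z1 z2.
    rewrite mem_set//.
    by split; rewrite /= in_itv/= -ler_norml (le_trans _ r34).
  by rewrite ler_nat.
rewrite (le_trans (ler_normD _ _))// mulrDl lerD//.
  rewrite (le_trans (Dt1 z))// ler_wpM2l// sub ?addr_ge0//.
  by rewrite lerDl.
rewrite normrM -mulrA; apply: ler_pM => //.
rewrite (le_trans (Dx2 z))// ler_wpM2l// sub ?addr_ge0//.
by rewrite lerDr.
Qed.

(** Since [eta] >= 0, multiplying [cone_test_transport] by it bounds the integrand of the entropy
    inequality by the difference of the two cone densities; Tonelli then reads their integrals as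
    averages just after a and just after b. *)
Lemma window_mass_le (g : R -> R) r a b h B :
  state_domain E D -> physical D F -> bounded_flow E F ->
  measurable_fun setT g -> (forall s, 0 <= g s) ->
  (forall x t, 0 <= t -> g (flow_entropy E F (x, t)) <= B) ->
  entropy_inequality E F g -> 0 < a -> a <= b -> 0 < h ->
  (\int[mu]_t ((weight b h t)%:E * cone_mass (flow_eta E F g) r L t) <=
   \int[mu]_t ((weight a h t)%:E * cone_mass (flow_eta E F g) r L t))%E.
Proof.
move=> SD phys bd mg g0 gB ent a0 ab h0.
have [rb ub _ _ _] := bd.
have L0 : 0 <= L by rewrite fine_ge0// Lnorm_ge0.
have b0 : 0 < b by exact: lt_le_trans ab.
have cmeta := measurable_flow_eta SD phys mg.
have HCHP : HP `<=` [set z : R * R | 0 <= z.2] by move=> z; exact: ltW.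
have meta : measurable_fun HP (flow_eta E F g).
  by apply: measurable_funS cmeta => //; exact: measurable_closed_half_plane.
have eta0 z : HP z -> 0 <= flow_eta E F g z.
  by move=> Hz; apply: (flow_eta_ge0 phys) => //; exact: ltW.
have [C etaC] := flow_eta_bounded phys bd g0 gB.
have intW c : (@lebesgue2 R).-integrable HP
    (EFin \o cone_density (flow_eta E F g) r L c h).
  exact: cone_density_integrable etaC.
rewrite -(integral_cone_density r cmeta L0 a0 h0 eta0).
rewrite -(integral_cone_density r cmeta L0 b0 h0 eta0).
pose th := cone_test r L a b h.
have tth : test_function th by exact: test_function_cone_test.
have := ent th tth (fun z => cone_test_ge0 r L z ab h0).
set G := (fun z => _ + _) => G0.
have mH := @measurable_half_plane R.
have [cDt Dt1] := derive_test_function (0, 1) tth.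
have [cDx Dx2] := derive_test_function (1, 0) tth.
have GE z : G z = flow_eta E F g z *
    ('D_(0, 1) th z + velocity F z * 'D_(1, 0) th z).
  rewrite /G /flow_eta.
  by move: ('D_(0, 1) th z) ('D_(1, 0) th z) => d1 d2; ring.
have uC := Linfty_norm_bound ub.
have [N [mN N0 uN]] := uC.
have mu' : measurable_fun HP (velocity F).
  have [_ _ _ _ [_ mu' _]] := phys.
  by apply: measurable_funS mu' => //; exact: measurable_closed_half_plane.
have intG : (@lebesgue2 R).-integrable HP (EFin \o G).
  rewrite (funext GE).
  exact: (flux_integrable mu' meta etaC uC cDt Dt1 cDx Dx2).
(* The entropy inequality concerns a real-valued integral, which is 0 by convention when the
   extended one is infinite; integrability transfers its sign to the extended integral. *)
have G0' : (0 <= \int[@lebesgue2 R]_(z in HP) (G z)%:E)%E.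
  have fG := integrable_fin_num mH intG.
  by rewrite -(fineK fG) lee_fin.
rewrite -sube_ge0; last first.
  by apply/orP; right; exact: (integrable_fin_num mH (intW _)).
rewrite -integralB//; [|exact: intW|exact: intW].
apply: (le_trans G0'); apply: ae_le_integral => //.
  by apply: integrableB => //; exact: intW.
exists N; split => //; apply: subset_trans uN; apply: subsetC => z /= + Hz.
move=> /(_ Hz) uL; rewrite -EFinB lee_fin GE /cone_density.
rewrite -mulrBr -(mulrA (flow_eta E F g z)).
apply: ler_wpM2l; first exact: eta0.
exact: cone_test_transport.
Qed.

End window_mass.

(** * Continuity in time *)

Section fast_L1.
Context d (T : measurableType d) {R : realType}.
Context (mu : {measure set T -> \bar R}) (I : set T).

(** The sum G of all the |f_n - f| has integral at most the sum of the 2 ^ (-(n + 1)), that is 1. So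
    G is finite almost everywhere, where the terms tend to 0, and it dominates every term: both
    ingredients of dominated convergence at once. *)
Lemma fast_L1_cvg (f_ : nat -> T -> R) (f : T -> R) :
  measurable I -> (forall n, measurable_fun I (f_ n)) -> measurable_fun I f ->
  (forall n,
    \int[mu]_(x in I) `|f_ n x - f x|%:E <= (1 / (2 ^ n.+1)%:R)%:E)%E ->
  exists G : T -> \bar R, [/\ mu.-integrable I G,
    forall x n, (`|f_ n x - f x|%:E <= G x)%E &
    {ae mu, forall x, I x -> f_ n x @[n --> \oo] --> f x}].
Proof.
move=> mI mf_ mf fast.
have mfn n : measurable_fun I (fun x => `|f_ n x - f x|%:E).
  apply/measurable_EFinP; apply: measurableT_comp => //.
  exact: measurable_funB.
pose G x := (\sum_(n <oo) `|f_ n x - f x|%:E)%E.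
have G0 x : (0 <= G x)%E by exact: nneseries_ge0.
have mG : measurable_fun I G by apply: ge0_emeasurable_sum => // *; exact: mfn.
have iG : mu.-integrable I G.
  apply/integrableP; split => //.
  under eq_integral do rewrite gee0_abs//.
  rewrite /G integral_nneseries//.
  apply: (@le_lt_trans _ _ 1%E); last exact: ltry.
  apply: le_trans (epsilon_trick0 predT (@ler01 R)).
  apply: lee_nneseries => [n _ _|n _]; last exact: fast.
  by apply: integral_ge0 => x _; rewrite lee_fin.
have leG x n : (`|f_ n x - f x|%:E <= G x)%E.
  rewrite /G (@nneseriesD1 _ _ n)//= leeDl// nneseries_ge0//.
exists G; split => //.
have [N [mN N0 GN]] := integrable_ae mI iG.
exists N; split => //; apply: subset_trans GN; apply: subsetC => x + Ix.
move=> /(_ Ix) Gfin.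
have Gy : (\sum_(0 <= n <oo) `|f_ n x - f x|%:E < +oo)%E.
  by rewrite ltey_eq Gfin.
have term0 n : true -> (0 <= `|f_ n x - f x|%:E)%E by rewrite lee_fin.
have tail := nneseries_tail_cvg Gy term0.
have : (`|f_ n x - f x|%:E @[n --> \oo] --> 0%E)%E.
  apply: squeeze_cvge (cvg_cst 0%E) tail; apply: nearW => n.
  rewrite lee_fin normr_ge0/=.
  apply: le_trans (nneseries_lim_ge n.+1 _) => //.
  by rewrite big_nat1.
move=> /fine_cvg /cvgr0Pnorm_le H; apply/cvgrPdist_le => e e0.
by apply: filterS (H e e0) => n /=; rewrite normr_id distrC.
Qed.

End fast_L1.

Section mass_continuity.
Context {R : realType} (E : eos R) (D : set (R * R)) (F : flow R).
Local Notation mu := (@lebesgue_measure R).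

Local Notation i0 := (@Ordinal 4 0 isT).
Local Notation i1 := (@Ordinal 4 1 isT).
Local Notation i2 := (@Ordinal 4 2 isT).
Local Notation U z := (flow_state F z 0).

Lemma flow_state0 z : U z i0 = cross_section F z.1 * density F z.
Proof. by rewrite /flow_state /conserved mxE. Qed.

Lemma flow_state1 z : U z i1 = cross_section F z.1 * density F z * velocity F z.
Proof. by rewrite /flow_state /conserved mxE. Qed.

Lemma flow_state2 z : U z i2 = cross_section F z.1 * density F z *
  (energy F z + velocity F z ^+ 2 / 2).
Proof. by rewrite /flow_state /conserved mxE. Qed.

(** As a rho > 0, the variables rho, u and eps are continuous functions of the conserved ones, and
    the entropy is continuous at the limit state. *)
Lemma flow_eta_cvg (g : R -> R) x (t_ : nat -> R) t :
  state_domain E D -> physical D F -> continuous g ->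
  (forall n, 0 <= t_ n) -> 0 <= t ->
  U (x, t_ n) i0 @[n --> \oo] --> U (x, t) i0 ->
  U (x, t_ n) i1 @[n --> \oo] --> U (x, t) i1 ->
  U (x, t_ n) i2 @[n --> \oo] --> U (x, t) i2 ->
  flow_eta E F g (x, t_ n) @[n --> \oo] --> flow_eta E F g (x, t).
Proof.
move=> SD phys cg t_0 t0 c0 c1 c2.
have [apos rpos _ _ _] := phys.
have U0 s : 0 <= s -> U (x, s) i0 != 0.
  by move=> s0; rewrite flow_state0 mulf_neq0// gt_eqF ?apos ?rpos.
have rE s : 0 <= s -> density F (x, s) = (cross_section F x)^-1 * U (x, s) i0.
  by move=> s0; rewrite flow_state0/= mulKf// gt_eqF.
have uE s : 0 <= s -> velocity F (x, s) = (U (x, s) i0)^-1 * U (x, s) i1.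
  by move=> s0; rewrite flow_state1/= -(flow_state0 (x, s)) mulKf ?U0.
have eE s : 0 <= s -> energy F (x, s) = (U (x, s) i0)^-1 * U (x, s) i2 -
    velocity F (x, s) * velocity F (x, s) / 2.
  move=> s0; rewrite flow_state2/= -(flow_state0 (x, s)) mulKf ?U0//.
  by rewrite expr2 addrK.
have cr : density F (x, t_ n) @[n --> \oo] --> density F (x, t).
  rewrite rE//; under eq_fun do rewrite rE//.
  by apply: cvgM => //; exact: cvg_cst.
have ciU : (U (x, t_ n) i0)^-1 @[n --> \oo] --> (U (x, t) i0)^-1.
  by apply: cvgV => //; exact: U0.
have cu : velocity F (x, t_ n) @[n --> \oo] --> velocity F (x, t).
  rewrite uE//; under eq_fun do rewrite uE//.
  exact: cvgM.
have ce : energy F (x, t_ n) @[n --> \oo] --> energy F (x, t).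
  rewrite eE//; under eq_fun do rewrite eE//.
  apply: cvgB; first exact: cvgM.
  by apply: cvgM; [exact: cvgM|exact: cvg_cst].
have cS : flow_entropy E F (x, t_ n) @[n --> \oo] --> flow_entropy E F (x, t).
  have cp : (density F (x, t_ n), energy F (x, t_ n)) @[n --> \oo] -->
      (density F (x, t), energy F (x, t)).
    exact: (@cvg_pair _ _ _ _ (nbhs (density F (x, t)))
      (nbhs (energy F (x, t)))).
  have cE := continuous_entropy (flow_eos_states SD phys x t0).
  exact: (cvg_comp _ _ cp cE).
rewrite /flow_eta/=; apply: cvgM.
  by apply: cvgM; [exact: cvg_cst|exact: cr].
exact: (cvg_comp _ g cS (cg _)).
Qed.

Lemma near_flow_state t0 r (i : 'I_4) (e : R) : time_continuous F ->
  0 <= t0 -> 0 < e ->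
  \forall t \near t0^'+,
    (\int[mu]_(x in `[(- r)%R, r]) `|U (x, t) i - U (x, t0) i|%:E <= e%:E)%E.
Proof.
move=> [_ tc] t00 e0.
have := tc i t0 r t00 [set y | (y < e%:E)%E].
have o : nbhs (0%E : \bar R) [set y | (y < e%:E)%E].
  apply: open_nbhs_nbhs; split; first exact: open_ereal_lt_ereal.
  by rewrite /= lte_fin.
move=> /(_ o); rewrite /= /fmap/= => H.
have : \forall t \near t0, 0 <= t ->
    (\int[mu]_(x in `[(- r)%R, r]) `|U (x, t) i - U (x, t0) i|%:E < e%:E)%E.
  have {}H : nbhs t0 (fun t => `[0, +oo[%classic t ->
      (\int[mu]_(x in `[(- r)%R, r]) `|U (x, t) i - U (x, t0) i|%:E
       < e%:E)%E) := H.
  by apply: filterS H => t H' t0'; apply: H'; rewrite /= in_itv/= t0'.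
apply: filterS => t H' tt0; apply/ltW/H'.
by rewrite (le_trans t00)// ltW.
Qed.

(** By contradiction: if the limit failed, some times t_n decreasing towards t0 fast enough for
    [fast_L1_cvg] would keep the mass outside a neighbourhood V of its value. Along them the
    conserved variables converge almost everywhere, and dominated convergence brings the mass back
    into V. *)
Lemma cone_mass_cvg (g : R -> R) B r L t0 :
  state_domain E D -> physical D F -> time_continuous F ->
  continuous g -> (forall s, 0 <= g s) ->
  (forall x t, 0 <= t -> g (flow_entropy E F (x, t)) <= B) -> 0 <= t0 ->
  cone_mass (flow_eta E F g) r L t0 \is a fin_num /\
  cone_mass (flow_eta E F g) r L t @[t --> t0^'+] -->
    cone_mass (flow_eta E F g) r L t0.
Proof.
move=> SD phys tc cg g0 gB t00.
have [apos rpos _ _ _] := phys.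
have B0 : 0 <= B by exact: le_trans (g0 _) (gB 0 t0 t00).
have mI : measurable (`[- r, r]%classic : set (measurableTypeR R)) by [].
pose f t x := flow_eta E F g (x, t) * cone r L (x, t).
have mf t : 0 <= t -> measurable_fun `[- r, r]%classic (f t).
  move=> tge0; apply: measurable_funTS; apply: measurable_funM.
    apply: measurable_slice tge0 _; apply: (measurable_flow_eta SD phys).
    exact: continuous_measurable_fun.
  apply: measurable_slice tge0 _; apply: measurable_funTS.
  exact: measurable_cone.
have mU i t : 0 <= t -> measurable_fun `[- r, r]%classic (fun x => U (x, t) i).
  by move=> tge0; apply: measurable_funTS; case: tc => /(_ i t tge0)[].
have U0ge0 x t : 0 <= t -> 0 <= U (x, t) i0.
  by move=> tge0; rewrite flow_state0 mulr_ge0// ltW ?apos ?rpos.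
have fle x t : 0 <= t -> `|f t x| <= B * U (x, t) i0.
  move=> tge0; rewrite /f flow_state0 mulrC.
  have c1 := cone_le1 r L (x, t); have c0 := cone_ge0 r L (x, t).
  have := gB x t tge0; have := g0 (flow_entropy E F (x, t)).
  rewrite /flow_eta; have := U0ge0 x t tge0; rewrite flow_state0.
  move: (cone _ _ _) (_ * density _ _) (g _) c1 c0 => c u k c1 c0 u0 k0 kB.
  rewrite ger0_norm; last by rewrite !mulr_ge0.
  rewrite mulrA [c * _]mulrC -mulrA [leRHS]mulrC; apply: ler_wpM2l => //.
  by rewrite -[leRHS]mul1r; apply: ler_pM.
have iU : mu.-integrable `[- r, r]%classic (fun x => (U (x, t0) i0)%:E).
  have [_ _ lU] := tc.1 i0 t0 t00.
  apply/integrableP; split; first by apply/measurable_EFinP; exact: mU.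
  by apply: lU => //; exact: segment_compact.
split.
  apply: integrable_fin_num => //.
  apply: (le_integrable mI) (integrableZl mI B iU) => //.
    by apply/measurable_EFinP; exact: mf.
  by move=> x _; rewrite -EFinM lee_fin (le_trans (fle _ _ t00))// ler_norm.
apply: contrapT => /existsNP[V /not_implyP[nV nmV]].
(* Closeness in time and in L^1 of all four components, the latter at the summable rate that
   [fast_L1_cvg] asks for. *)
pose P n t := [/\ t0 < t, t < t0 + n.+1%:R^-1 &
  forall i : 'I_4, (\int[mu]_(x in `[(- r)%R, r])
    `|U (x, t) i - U (x, t0) i|%:E <= (1 / (2 ^ n.+1)%:R)%:E)%E].
have nearP n : \forall t \near t0^'+, P n t.
  have e0 : 0 < 1 / (2 ^ n.+1)%:R :> R by rewrite divr_gt0// ltr0n expn_gt0.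
  have nearU : \forall t \near t0^'+, forall i : 'I_4,
      (\int[mu]_(x in `[(- r)%R, r]) `|U (x, t) i - U (x, t0) i|%:E <=
      (1 / (2 ^ n.+1)%:R)%:E)%E.
    apply: filter_forall => i; exact: (near_flow_state r i tc t00 e0).
  near=> t; split; near: t.
  - exact: nbhs_right_gt.
  - by apply: nbhs_right_lt; rewrite ltrDl invr_gt0.
  - exact: nearU.
have exP n : exists t, P n t /\ ~ V (cone_mass (flow_eta E F g) r L t).
  apply: contrapT => H; apply: nmV; apply: filterS (nearP n) => t Pt.
  by apply: contrapT => nVt; apply: H; exists t.
have [t_ Pt_] := choice exP.
have t_0 n : 0 <= t_ n.
  by have [[t0t _ _] _] := Pt_ n; exact: le_trans t00 (ltW t0t).
have t_t0 : t_ n @[n --> \oo] --> t0.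
  apply: (@squeeze_cvgr _ _ _ _ (fun=> t0) (fun n => t0 + harmonic n)).
  - apply: nearW => n; have [[/ltW t1 /ltW t2 _] _] := Pt_ n.
    by rewrite t1.
  - exact: cvg_cst.
  - rewrite -[X in _ --> X]addr0; apply: cvgD; first exact: cvg_cst.
    exact: cvg_harmonic.
have fast i := @fast_L1_cvg _ _ R mu _ (fun n x => U (x, t_ n) i)
  (fun x => U (x, t0) i) mI (fun n => mU i _ (t_0 n)) (mU i _ t00)
  (fun n => let: conj (And3 _ _ H) _ := Pt_ n in H i).
have [G [iG leG [N0 [mN0 N00 cN0]]]] := fast i0.
have [_ [_ _ [N1 [mN1 N10 cN1]]]] := fast i1.
have [_ [_ _ [N2 [mN2 N20 cN2]]]] := fast i2.
have fcvg : {ae mu, forall x, `[- r, r]%classic x ->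
    (f (t_ n) x)%:E @[n --> \oo] --> (f t0 x)%:E}.
  exists (N0 `|` N1 `|` N2); split.
  - by apply: measurableU => //; exact: measurableU.
  - by rewrite measureU0// ?measureU0//; exact: measurableU.
  move=> x; apply: contra_notP => /not_orP[/not_orP[x0 x1] x2] Ix.
  have {}x0 : U (x, t_ n) i0 @[n --> \oo] --> U (x, t0) i0.
    by apply: contrapT => H; apply: x0; apply: cN0 => /= /(_ Ix).
  have {}x1 : U (x, t_ n) i1 @[n --> \oo] --> U (x, t0) i1.
    by apply: contrapT => H; apply: x1; apply: cN1 => /= /(_ Ix).
  have {}x2 : U (x, t_ n) i2 @[n --> \oo] --> U (x, t0) i2.
    by apply: contrapT => H; apply: x2; apply: cN2 => /= /(_ Ix).
  apply: cvg_EFin; first exact: nearW.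
  apply: cvgM; first exact: flow_eta_cvg.
  have cp : (x, t_ n) @[n --> \oo] --> (x, t0).
    by apply: (@cvg_pair _ _ _ _ (nbhs x) (nbhs t0)) => //; exact: cvg_cst.
  exact: (cvg_comp _ _ cp (@continuous_cone _ r L (x, t0))).
(* The dominating function comes from a rho at t_n <= a rho at t0 + G, where G is the one built for
   the component a rho. *)
have iG' : mu.-integrable `[- r, r]%classic
    (fun x => B%:E * ((U (x, t0) i0)%:E + G x))%E.
  by apply: integrableZl => //; exact: integrableD.
have mF t : 0 <= t ->
    measurable_fun `[- r, r]%classic (fun x => (f t x)%:E).
  by move=> tge0; apply/measurable_EFinP; exact: mf.
have dom : {ae mu, forall x n, `[- r, r]%classic x ->
    (`|(f (t_ n) x)%:E| <= B%:E * ((U (x, t0) i0)%:E + G x))%E}.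
  apply: aeW => x n Ix.
  apply: (@le_trans _ _ (B%:E * (U (x, t_ n) i0)%:E)%E).
    by rewrite -EFinM lee_fin fle.
  rewrite lee_wpmul2l ?lee_fin//.
  apply: (@le_trans _ _
      ((U (x, t0) i0)%:E + `|U (x, t_ n) i0 - U (x, t0) i0|%:E)%E).
    rewrite -EFinD lee_fin.
    by have := ler_norm (U (x, t_ n) i0 - U (x, t0) i0); lra.
  by rewrite leeD2l.
have [_ _ cI] := dominated_convergence mI (fun n => mF _ (t_0 n)) (mF _ t00)
  fcvg iG' dom.
have [n _ Hn] := cI V nV.
by have [_ nVn] := Pt_ n; apply: nVn; exact: (Hn n (leqnn n)).
Unshelve. all: by end_near. Qed.

End mass_continuity.

(** * Conclusion *)

Section mass_decrease.
Context {R : realType} (E : eos R) (D : set (R * R)) (F : flow R).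
Local Notation mu := (@lebesgue_measure R).
Local Notation L := (fine (Linfty_norm (velocity F))).

Lemma near_at_right (t0 : R) (P : R -> Prop) :
  (\forall t \near t0^'+, P t) ->
  exists2 d, 0 < d & forall t, t0 < t < t0 + d -> P t.
Proof.
move=> [d /= d0 dP]; exists d => // t /andP[t1 t2].
by apply: dP => //=; rewrite ltr0_norm ?subr_lt0// opprB ltrBlDl.
Qed.

(** If m 0 < m t, right limits give levels A < B' with m < A shortly after 0 and m > B' shortly
    after t. Averages against probability densities carried by these intervals are then ordered the
    wrong way. *)
Lemma window_average_le (m : R -> \bar R) t : 0 < t ->
  (forall s, 0 <= s -> (0 <= m s)%E) ->
  m 0 \is a fin_num -> m t \is a fin_num ->
  m s @[s --> 0^'+] --> m 0 -> m s @[s --> t^'+] --> m t ->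
  (forall c q, 0 < c -> 0 < q ->
    measurable_fun setT (fun s => (weight c q s)%:E * m s)%E) ->
  (forall q, 0 < q ->
    (\int[mu]_s ((weight (t + q) q s)%:E * m s) <=
     \int[mu]_s ((weight q q s)%:E * m s))%E) ->
  (m t <= m 0%R)%E.
Proof.
move=> t0 m0 fin0 fint cvg0 cvgt mwm m_window.
rewrite leNgt; apply/negP; rewrite -(fineK fin0) -(fineK fint) lte_fin => lt0t.
(* A and B' cut the interval from m 0 to m t into thirds. *)
pose A := (2 * fine (m 0) + fine (m t)) / 3.
pose B' := (fine (m 0) + 2 * fine (m t)) / 3.
have mA : (m 0%R < A%:E)%E by rewrite -(fineK fin0) lte_fin /A; lra.
have AB' : A < B' by rewrite /A /B'; lra.
have B'm : (B'%:E < m t)%E by rewrite -(fineK fint) lte_fin /B'; lra.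
have A0 : 0 <= A by rewrite -lee_fin (le_trans (m0 0 _))// ltW.
have [d d0 dA] : exists2 d, 0 < d & forall s, 0 < s < 0 + d -> (m s < A%:E)%E.
  apply: near_at_right; apply: (cvg0 [set y | (y < A%:E)%E]).
  by apply: open_nbhs_nbhs; split => //; exact: open_ereal_lt_ereal.
have [d' d'0 dB] : exists2 d, 0 < d &
    forall s, t < s < t + d -> (B'%:E < m s)%E.
  apply: near_at_right; apply: (cvgt [set y | (B'%:E < y)%E]).
  by apply: open_nbhs_nbhs; split => //; exact: open_ereal_gt_ereal.
(* The weights live on [q, 2 q] and [t + q, t + 2 q]; the factor 3 puts both strictly inside the
   intervals of lengths d and d'. *)
pose q := Num.min d d' / 3.
have q0 : 0 < q by rewrite divr_gt0// lt_min d0.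
have qd : q + q < d.
  have : q * 3 <= d by rewrite /q divfK// ge_min lexx.
  lra.
have qd' : q + q < d'.
  have : q * 3 <= d' by rewrite /q divfK// ge_min lexx orbT.
  lra.
have := m_window q q0.
apply/negP; rewrite -ltNge.
have wm0 c s : 0 < c -> (0 <= (weight c q s)%:E * m s)%E.
  move=> c0; have [s0|s0] := ltP s 0; last first.
    by rewrite mule_ge0 ?m0// lee_fin weight_ge0.
  rewrite weight_out ?mul0e// negb_and -ltNge.
  by rewrite (lt_trans s0 c0).
have mw c : measurable_fun setT (fun s => (weight c q s)%:E).
  apply/measurable_EFinP; apply: continuous_measurable_fun.
  exact: continuous_weight.
have wE c (K : R) : 0 <= K -> (\int[mu]_s (K%:E * (weight c q s)%:E) = K%:E)%E.
  move=> K0; rewrite ge0_integralZl//.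
  - by rewrite integral_weight// mule1.
  - exact: mw.
  - by move=> s _; rewrite lee_fin weight_ge0.
have B'0 : 0 <= B' by rewrite (le_trans A0)// ltW.
apply: (@le_lt_trans _ _ (\int[mu]_s (A%:E * (weight q q s)%:E))%E).
  apply: ge0_le_integral => //.
  - by move=> s _; exact: wm0.
  - exact: mwm.
  - by apply: measurable_funeM; exact: mw.
  - move=> s _; rewrite muleC.
    have [/andP[qs sq]|sq] := boolP (q <= s <= q + q); last first.
      by rewrite weight_out// !mule0.
    rewrite lee_wpmul2r ?lee_fin ?weight_ge0// ltW// dA//.
    by rewrite add0r (lt_le_trans q0 qs) (le_lt_trans sq qd).
apply: (@lt_le_trans _ _ (\int[mu]_s (B'%:E * (weight (t + q) q s)%:E))%E).
  by rewrite !wE// lte_fin.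
apply: ge0_le_integral => //.
- by move=> s _; rewrite -EFinM lee_fin mulr_ge0// weight_ge0.
- by apply: measurable_funeM; exact: mw.
- by apply: mwm => //; exact: addr_gt0.
- move=> s _; rewrite [leRHS]muleC.
  have [/andP[qs sq]|sq] := boolP (t + q <= s <= t + q + q); last first.
    by rewrite weight_out// !mule0.
  rewrite lee_wpmul2r ?lee_fin ?weight_ge0// ltW// dB//.
  by apply/andP; split; lra.
Qed.

Lemma cone_mass_ge0 (g : R -> R) r t : physical D F -> (forall s, 0 <= g s) ->
  0 <= t -> (0 <= cone_mass (flow_eta E F g) r L t)%E.
Proof.
move=> phys g0 t0; apply: integral_ge0 => x _; rewrite lee_fin.
by apply: mulr_ge0; [exact: (flow_eta_ge0 _ phys)|exact: cone_ge0].
Qed.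

Lemma cone_mass_le (g : R -> R) r t B :
  state_domain E D -> physical D F -> time_continuous F -> bounded_flow E F ->
  continuous g -> (forall s, 0 <= g s) ->
  (forall x t, 0 <= t -> g (flow_entropy E F (x, t)) <= B) ->
  entropy_inequality E F g -> 0 < t ->
  (cone_mass (flow_eta E F g) r L t <= cone_mass (flow_eta E F g) r L 0)%E.
Proof.
move=> SD phys tc bd cg g0 gB ent t0.
have [fin0 cvg0] := cone_mass_cvg r L SD phys tc cg g0 gB (lexx 0).
have [fint cvgt] := cone_mass_cvg r L SD phys tc cg g0 gB (ltW t0).
have mg := continuous_measurable_fun cg.
have [rb ub _ _ _] := bd.
have L0 : 0 <= L by rewrite fine_ge0// Lnorm_ge0.
have cmeta := measurable_flow_eta SD phys mg.
have eta0 z : half_plane z -> 0 <= flow_eta E F g z.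
  by move=> Hz; apply: (flow_eta_ge0 _ phys) => //; exact: ltW.
apply: (window_average_le t0 _ fin0 fint cvg0 cvgt).
- by move=> s s0; exact: cone_mass_ge0.
- by move=> c q c0 q0; exact: measurable_weighted_cone_mass.
- move=> q q0.
  apply: (window_mass_le r SD phys bd mg g0 gB ent q0 _ q0).
  by rewrite lerDr ltW.
Qed.

End mass_decrease.

(** * Admissibility of the exponential entropies *)

Section exponential_entropy.
Context {R : realType}.

Implicit Types k s y : R.

Definition exp_entropy k s y : R := expR (k * (s - y)).

Lemma is_derive_exp_entropy k s y :
  is_derive y 1 (exp_entropy k s) (- k * exp_entropy k s y).
Proof.
have d1 : is_derive y 1 (fun y => k * (s - y)) (- k).
  have := is_deriveZ k
    (is_deriveB (is_derive_cst s y (1 : R)) (is_derive_id y (1 : R))).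
  by move=> d; apply: (is_derive_eq d); rewrite sub0r /GRing.scale/= mulrN1.
have := @is_derive1_comp _ expR _ y _ _ (is_derive_expR _) d1.
by move=> d; apply: (is_derive_eq d); rewrite mulrC.
Qed.

Lemma continuous_exp_entropy k s : continuous (exp_entropy k s).
Proof.
move=> y; apply/differentiable_continuous/derivable1_diffP.
by case: (is_derive_exp_entropy k s y).
Qed.

(** Strictness comes from the strict concavity of S and the strict monotonicity of exp; after that,
    plain convexity of exp suffices, obtained from its tangent line. *)
Lemma entropy_function_exp (E : eos R) (D : set (R * R)) k s :
  state_domain E D -> 0 < k -> entropy_function E D (exp_entropy k s).
Proof.
move=> [DE _ _] k0; split.
- have dE : derive1 (exp_entropy k s) = (fun y => - k * exp_entropy k s y).
    by apply/funext => y; rewrite derive1E; case: (is_derive_exp_entropy k s y).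
  move=> y; split; first by case: (is_derive_exp_entropy k s y).
  rewrite dE; apply: derivableM=> //.
- by move=> z w _ _ zw; rewrite ltr_expR ltr_pM2l// ltrD2l ltrN2.
- move=> z w l Dz Dw zw /[dup] l01 /andP[l0 l1].
  have := entropy_concave (DE _ Dz) (DE _ Dw) zw l01.
  rewrite /= /exp_entropy.
  move: (entropy E (inv_fst (l *: z + _))) (entropy E (inv_fst z))
    (entropy E (inv_fst w)) => Sm Sz Sw.
  rewrite !mulrN -opprD ltrN2 => Slt.
  (* m is the average of the exponents at z and w, so the linear terms of the two tangent
     inequalities at m cancel in the weighted sum. *)
  pose m := k * (s - (l * Sz + (1 - l) * Sw)).
  apply: (@lt_le_trans _ _ (expR m)).
    by rewrite ltr_expR ltr_pM2l// ltrD2l ltrN2.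
  have tangent y : expR m * (1 + (y - m)) <= expR y.
    have -> : expR y = expR m * expR (y - m) by rewrite -expRD subrKC.
    by rewrite ler_pM2l ?expR_gt0// expR_ge1Dx.
  have H1 := ler_wpM2l (ltW l0) (tangent (k * (s - Sz))).
  have l1' : 0 <= 1 - l by rewrite subr_ge0 ltW.
  have H2 := ler_wpM2l l1' (tangent (k * (s - Sw))).
  apply: le_trans (lerD H1 H2).
  rewrite [leRHS](_ : _ =
      expR m * (1 + (k * (s - (l * Sz + (1 - l) * Sw)) - m))).
    by rewrite subrr addr0 mulr1.
  ring.
Qed.

End exponential_entropy.

(** * Essential infima over centred intervals *)

Section centered_infimum.
Context {R : realType}.
Local Notation mu := (@lebesgue_measure R).

Lemma ae_mrestr_itv r (P : R -> Prop) :
  {ae mrestr mu (measurable_itv `[- r, r]), forall x, P x} <->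
  {ae mu, forall x : R, `[- r, r]%classic x -> P x}.
Proof.
split=> -[N [mN N0 PN]].
  exists (N `&` `[- r, r]%classic); split => //; first exact: measurableI.
  by move=> x /= /not_implyP[Ix nPx]; split => //; exact: PN.
exists (N `|` ~` `[- r, r]%classic); split.
- by apply: measurableU => //; exact: measurableC.
- rewrite /mrestr/= setIUl setICl setU0.
  apply: (subset_measure0 _ _ (@subIsetl _ _ _) N0) => //.
  exact: measurableI.
- move=> x /= nPx; have [Ix|] := pselect (`[- r, r]%classic x); last by right.
  by left; apply: PN => /= /(_ Ix).
Qed.

(** The essential infimum is the supremum of the almost-everywhere lower bounds, so it is enough to
    transfer real lower bounds. *)
Lemma le_essinf_centered (r1 r2 : R) (f1 f2 : R -> R) : 0 < r1 ->
  (forall s : R, {ae mu, forall x, `[- r1, r1]%classic x -> s <= f1 x} ->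
    {ae mu, forall x, `[- r2, r2]%classic x -> s <= f2 x}) ->
  (essinf_centered r1 f1 <= essinf_centered r2 f2)%E.
Proof.
move=> r10 H.
have Hr (s : R) : {ae mu, forall x, `[- r1, r1]%classic x -> s <= f1 x} ->
    (s%:E <= essinf_centered r2 f2)%E.
  move=> /H f2s; apply: ereal_sup_ubound => /=.
  by apply/(ae_mrestr_itv r2 (fun x => (s%:E <= (f2 x)%:E)%E)).
apply: ge_ereal_sup => y /= fy.
have {}fy := (ae_mrestr_itv r1 (fun x => (y <= (f1 x)%:E)%E)).1 fy.
case: y fy => [s fs|[N [mN N0 fN]]|_]; last exact: leNye.
  exact: Hr.
(* A lower bound [+oo] of a real function makes the first interval negligible, so every real A is a
   lower bound too. *)
suff /eqyP -> : forall A : R, 0 < A -> (A%:E <= essinf_centered r2 f2)%E by [].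
move=> A A0; apply: Hr; exists N; split => //.
by move=> x /= /not_implyP[Ix _]; apply: fN => /= /(_ Ix).
Qed.

End centered_infimum.

Lemma ae_entropy_lower_bound (R : realType) (E : eos R) (D : set (R * R))
    (F : flow R) (r t s : R) :
  state_domain E D -> physical D F -> time_continuous F -> bounded_flow E F ->
  (forall g, entropy_function E D g -> entropy_inequality E F g) ->
  0 < r -> 0 < t ->
  let L := fine (Linfty_norm (velocity F)) in
  {ae @lebesgue_measure R, forall x, `[- (r + t * L), r + t * L]%classic x ->
    s <= flow_entropy E F (x, 0)} ->
  {ae @lebesgue_measure R, forall x, `[- r, r]%classic x ->
    s <= flow_entropy E F (x, t)}.
Proof.
move=> SD phys tc bd ent r0 t0 L S0.
have [apos rpos _ _ _] := phys.
have L0 : 0 <= L by rewrite fine_ge0// Lnorm_ge0.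
pose r' := r + t * L.
have rr' : r <= r' by rewrite lerDl mulr_ge0// ltW.
have mI : measurable (`[- r', r']%classic : set (measurableTypeR R)) by [].
have [M SM] := flow_entropy_bounded SD phys.
pose u x tau := cross_section F x * density F (x, tau).
have u0 x tau : 0 <= tau -> 0 < u x tau.
  by move=> tau0; rewrite mulr_gt0// ?apos ?rpos.
have uE x tau : u x tau = flow_state F (x, tau) 0 (@Ordinal 4 0 isT).
  by rewrite flow_state0.
have mu' tau : 0 <= tau ->
    measurable_fun `[- r', r']%classic (fun x => u x tau).
  move=> tau0; rewrite (funext (uE^~ tau)).
  by apply: measurable_funTS; case: tc => /(_ (@Ordinal 4 0 isT) tau tau0)[].
have mC tau : 0 <= tau ->
    measurable_fun `[- r', r']%classic (fun x => cone r' L (x, tau)).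
  move=> tau0; apply: measurable_funTS; apply: measurable_slice tau0 _.
  by apply: measurable_funTS; exact: measurable_cone.
have mS tau : 0 <= tau ->
    measurable_fun `[- r', r']%classic (fun x => flow_entropy E F (x, tau)).
  move=> tau0; apply: measurable_funTS; apply: measurable_slice tau0 _.
  exact: measurable_flow_entropy SD phys.
pose mass k tau := cone_mass (flow_eta E F (exp_entropy k s)) r' L tau.
have ge0 k y : 0 <= exp_entropy k s y by exact: expR_ge0.
have mass_le n : (mass n.+1%:R t <= mass n.+1%:R 0%R)%E.
  (* This bound on g_k may grow with n: it serves only to make the masses finite and comparable at
     fixed n. *)
  apply: (@cone_mass_le R E D F _ r' t (expR (n.+1%:R * (`|s| + M)))) => //.
  - exact: continuous_exp_entropy.
  - move=> x tau tau0; rewrite ler_expR ler_pM2l ?ltr0n//.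
    by rewrite lerD ?ler_norm// (le_trans _ (SM x tau tau0))// -normrN ler_norm.
  - by apply: ent; apply: entropy_function_exp SD _; rewrite ltr0n.
pose C := (\int[@lebesgue_measure R]_(x in `[(- r')%R, r']) (u x 0%R)%:E)%E.
have C_fin : (C < +oo)%E.
  have [_ _ /(_ `[- r', r']%classic)] := tc.1 (@Ordinal 4 0 isT) 0 (lexx 0).
  move=> /(_ (@subsetT _ _) (@segment_compact _ _ _)); apply: le_lt_trans.
  apply: ge0_le_integral => //.
  - by move=> x _; rewrite lee_fin; exact/ltW/u0/lexx.
  - by apply/measurable_EFinP; exact: mu'.
  - apply/measurable_EFinP; apply: measurableT_comp => //.
    apply: measurable_funTS.
    by case: tc => /(_ (@Ordinal 4 0 isT) 0 (lexx _))[].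
  - by move=> x _; rewrite lee_fin uE ler_norm.
(* The bound C does not depend on n: where S >= s at time 0 the exponential is at most 1, and so is
   the cone. *)
have mass0 n : (mass n.+1%:R 0%R <= C)%E.
  apply: ae_ge0_le_integral => //.
  - move=> x _; rewrite lee_fin; apply: mulr_ge0; last exact: cone_ge0.
    by apply: (flow_eta_ge0 _ phys) => //.
  - apply/measurable_EFinP; apply: measurable_funM; last exact: mC.
    apply: measurable_funTS; apply: measurable_slice (lexx 0) _.
    apply: (measurable_flow_eta SD phys).
    by apply: continuous_measurable_fun; exact: continuous_exp_entropy.
  - by move=> x _; rewrite lee_fin; exact/ltW/u0/lexx.
  - by apply/measurable_EFinP; exact: mu'.
  - have [N [mN N0 SN]] := S0; exists N; split => //; apply: subset_trans SN.
    apply: subsetC => x /= + Ix => /(_ Ix) sS.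
    rewrite lee_fin -[leRHS]mulr1; apply: ler_pM.
    + exact: (flow_eta_ge0 _ phys).
    + exact: cone_ge0.
    + rewrite -[leRHS]mulr1; apply: ler_pM => //; first exact/ltW/u0.
      by rewrite expR_le1 mulr_ge0_le0// subr_le0.
    + exact: cone_le1.
pose h x := u x t * cone r' L (x, t) *
  Num.max 0 (s - flow_entropy E F (x, t)).
have h0 x : 0 <= h x.
  apply: mulr_ge0; last by rewrite le_max lexx.
  by apply: mulr_ge0; [exact/ltW/u0/ltW|exact: cone_ge0].
have mh : measurable_fun `[- r', r']%classic h.
  apply: measurable_funM.
    by apply: measurable_funM; [apply: mu'|apply: mC]; exact: ltW.
  apply: measurable_maxr => //; apply: measurable_funB => //.
  by apply: mS; exact: ltW.
have mhE : measurable_fun `[- r', r']%classic (EFin \o h).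
  exact/measurable_EFinP.
pose J := (\int[@lebesgue_measure R]_(x in `[(- r')%R, r']) (h x)%:E)%E.
have J0 : (0 <= J)%E by apply: integral_ge0 => x _; rewrite lee_fin.
have JC n : (n.+1%:R%:E * J <= C)%E.
  apply: le_trans (mass0 n); apply: le_trans (mass_le n).
  rewrite -ge0_integralZl//; last first.
    by move=> x _; rewrite lee_fin.
  apply: ge0_le_integral => //.
  - by move=> x _; rewrite -EFinM lee_fin mulr_ge0.
  - exact: measurable_funeM.
  - apply/measurable_EFinP; apply: measurable_funM; last first.
      by apply: mC; exact: ltW.
    apply: measurable_funTS; apply: measurable_slice (ltW t0) _.
    apply: (measurable_flow_eta SD phys).
    by apply: continuous_measurable_fun; exact: continuous_exp_entropy.
  - move=> x _; rewrite -EFinM lee_fin /h /flow_eta mulrCA mulrAC /exp_entropy.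
    rewrite -[X in X * _ * _]/(u x t); apply: ler_wpM2r; first exact: cone_ge0.
    apply: ler_wpM2l; first exact/ltW/u0/ltW.
    set y := s - _; have [y0|y0] := leP y 0.
      by rewrite mulr0 expR_ge0.
    apply: le_trans (expR_ge1Dx _).
    by rewrite lerDr.
have J_eq0 : J = 0%E.
  have C0 : (0 <= C)%E by rewrite (le_trans _ (JC 0)) ?mule_ge0 ?lee_fin.
  have Cf : C \is a fin_num by rewrite ge0_fin_numE.
  have Jf : J \is a fin_num.
    rewrite ge0_fin_numE// (le_lt_trans _ C_fin)//.
    by have := JC 0%N; rewrite mul1e.
  apply/eqP; rewrite eq_le J0 andbT -(fineK Jf) lee_fin leNgt.
  (* Archimedes: n + 1 exceeds C / J for n the integer part of C / J, against (n + 1) J <= C. *)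
  apply/negP => j0; have := JC (Num.truncn (fine C / fine J)).
  rewrite -(fineK Jf) -(fineK Cf) -EFinM lee_fin leNgt => /negP; apply.
  by rewrite -ltr_pdivrMr// truncnS_gt.
have [N [mN N0 hN]] :
    ae_eq (@lebesgue_measure R) `[- r', r']%classic (EFin \o h) (cst 0%E).
  apply/(ae_eq_integral_abs _ mI mhE); rewrite -J_eq0.
  by apply: eq_integral => x _; rewrite /= ger0_norm.
(* At time t the cone is known to be positive for |x| < r' - L t = r, so the two endpoints join the
   null set. *)
exists (N `|` ([set - r] `|` [set r])); split.
- by apply: measurableU => //; exact: measurableU.
- have r_null : @lebesgue_measure R ([set - r] `|` [set r]) = 0%E.
    have m1 (y : R) : measurable ([set y] : set (measurableTypeR R)) by [].
    by rewrite (measureU0 (m1 _) (m1 _)); exact: lebesgue_measure_set1.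
  by rewrite (measureU0 mN _ r_null)//; exact: measurableU.
- move=> x; apply: contra_notP => /not_orP[xN /not_orP[xr1 xr2]].
  rewrite /= in_itv/= => /andP[x1 x2].
  have xr : `|x| < r.
    by rewrite ltr_norml !lt_neqAle x1 x2 !andbT eq_sym; apply/andP; split;
      apply/eqP.
  have Ix : `[- r', r']%classic x.
    by rewrite /= in_itv/= -ler_norml (le_trans (ltW xr)).
  have hx : h x = 0.
    by apply: contrapT => H; apply: xN; apply: hN => /= /(_ Ix) -[].
  have c0 : 0 < u x t * cone r' L (x, t).
    apply: mulr_gt0; first exact/u0/ltW.
    by apply: cone_gt0; rewrite /= /r' mulrC [L * t]mulrC; lra.
  move: hx => /eqP; rewrite mulf_eq0 gt_eqF//= => /eqP mx.
  by rewrite -subr_le0 -mx le_max lexx orbT.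
Qed.

Theorem theorem3p2 (R : realType) (E : eos R) (D : set (R * R))
    (phi : R -> 'rV[R]_4 -> 'rV[R]_4 -> 'rV[R]_4) (F : flow R) :
  state_domain E D ->
  lipschitz_paths (phase_space E) phi ->
  entropy_solution E D phi F ->
  bounded_flow E F ->
  forall r t : R, 0 < r -> 0 < t ->
    (essinf_centered (r + t * fine (Linfty_norm (velocity F)))%R
       (fun x => flow_entropy E F (x, 0%R))
     <= essinf_centered r (fun x => flow_entropy E F (x, t)))%E.
Proof.
move=> SD _ [phys tc _ ent] bd r t r0 t0.
apply: le_essinf_centered => [|s].
  rewrite ltr_wpDr// mulr_ge0 ?fine_ge0// ?Lnorm_ge0//; exact: ltW.
exact: (ae_entropy_lower_bound SD phys tc bd ent r0 t0).
Qed.
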